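(* Let $\Theta \subseteq \mathbb{R}^d$, let $U:\mathbb{R}^d \to \mathbb{R}$ be a differentiable energy function, and fix a step size $\epsilon>0$, a momentum scale $\sigma>0$, a friction parameter $\beta>0$ and an integer $T \ge 1$. Let $\pi(\theta) \propto \exp(-U(\theta))$ on $\Theta$, and let $\pi(\theta, r) \propto \exp\!\big(-U(\theta) - \tfrac{1}{2\sigma^2}\|r\|^2\big)$ on $\Theta \times \mathbb{R}^d$. Consider the Markov chain (AMAGOLD) whose state is $(\theta, r) \in \Theta\times\mathbb{R}^d$ and one transition of which is: 1. (Optionally) resample the momentum $r \sim \mathcal{N}(0, \sigma^2 I)$. 2. Set $r_{-1/2} = r$, $\rho_{-1/2} = 0$, and $\theta_0 = \theta + \tfrac12 \epsilon \sigma^{-2} r_{-1/2}$. 3. For $t = 0, 1, \ldots, T-1$: if $t \neq 0$, set $\theta_t = \theta_{t-1} + \epsilon \sigma^{-2} r_{t-1/2}$; sample $\eta_t \sim \mathcal{N}(0, 4\epsilon\beta\sigma^2 I)$; sample a random energy component $\tilde U_t$; set $r_{t+1/2} = \big((1-\epsilon\beta) r_{t-1/2} - \epsilon \nabla \tilde U_t(\theta_t) + \eta_t\big)/(1+\epsilon\beta)$ and $\rho_{t+1/2} = \rho_{t-1/2} + \tfrac12 \epsilon\sigma^{-2} \nabla \tilde U_t(\theta_t)^{\top}(r_{t-1/2} + r_{t+1/2})$. 4. Set $\theta_T = \theta_{T-1} + \tfrac12 \epsilon\sigma^{-2} r_{T-1/2}$, $\theta^* = \theta_T$, $r^* = r_{T-1/2}$,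 and $a = \exp\big(U(\theta) - U(\theta^* ) + \rho_{T-1/2}\big)$. 5. With probability $\min(1,a)$ (and provided $\theta^* \in \Theta$) move to $(\theta, r) \leftarrow (\theta^*, r^* )$; otherwise set $r \leftarrow -r_{-1/2}$ (keeping $\theta$). If the momentum is resampled in step 1 at every transition, then this Markov chain (viewed as a chain on $\theta$) is reversible with stationary distribution $\pi(\theta)$. If the momentum is not resampled, the Markov chain on $(\theta, r)$ is skew-reversible with respect to the involution $(\theta,r)^\perp = (\theta,-r)$, and its stationary distribution is $\pi(\theta, r)$ (whose $\theta$-marginal is $\pi(\theta)$).
   Context: The random energy components $\tilde U_0, \ldots, \tilde U_{T-1}$ are random differentiable functions (e.g. minibatch estimates $\tilde U(\theta) = -\frac{|\mathcal D|}{|\tilde{\mathcal D}|}\sum_{x\in\tilde{\mathcal D}} \log p(x\mid\theta) - \log p(\theta)$ of $U(\theta) = -\sum_{x\in\mathcal D}\log p(x\mid\theta) - \log p(\theta)$) drawn i.i.d. from a fixed distribution, independently of the state and of the Gaussian noise. A Markov chain with transition kernel $G$ is reversible with respect to $\pi$ if $\pi(x)G(x,y) = \pi(y)G(y,x)$ for all states $x,y$. Given a measure-preserving involution $x \mapsto x^\perp$ of the state space, $G$ is skew-reversible if $\pi(x) = \pi(x^\perp)$ and $\pi(x) G(x,y) = \pi(y^\perp) G(y^\perp, x^\perp)$ for all $x, y$. *)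

(* Defs.v *)
From HB Require Import structures.
From mathcomp Require Import all_boot all_order all_algebra.
From mathcomp Require Import all_classical all_reals all_analysis.
Set Implicit Arguments. Unset Strict Implicit. Unset Printing Implicit Defensive.
Import Order.TTheory GRing.Theory Num.Theory.
Import numFieldNormedType.Exports.
Local Open Scope classical_set_scope.
Local Open Scope ring_scope.

(* Borel sigma-algebra on row vectors 'rV[T]_n: generated by the coordinates
   (same construction as the library's instance on n.-tuple T). *)
Definition rV_display : measure_display -> measure_display.
Proof. exact. Qed.

Section measurable_rV.
Context {d} {T : sigmaRingType d}.
Variable n : nat.

Let coors : 'I_n -> 'rV[T]_n -> T := fun i x => x ord0 i.

Let rV_set0 : g_sigma_preimage coors set0.
Proof. exact: sigma_algebra0. Qed.

Let rV_setC A : g_sigma_preimage coors A -> g_sigma_preimage coors (~` A).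
Proof. exact: sigma_algebraC. Qed.

Let rV_bigcup (F : _^nat) : (forall i, g_sigma_preimage coors (F i)) ->
  g_sigma_preimage coors (\bigcup_i (F i)).
Proof. exact: sigma_algebra_bigcup. Qed.

HB.instance Definition _ := @isMeasurable.Build (rV_display d)
  'rV[T]_n (g_sigma_preimage coors) rV_set0 rV_setC rV_bigcup.

End measurable_rV.


Section amagold.
Context {R : realType}.
Local Notation vec d := 'rV[R]_d.

Definition dotv {d} (u v : vec d) : R := \sum_(i < d) u ord0 i * v ord0 i.
Definition sqnormv {d} (u : vec d) : R := dotv u u.

Definition gradv {d} (f : vec d -> R) (x : vec d) : vec d :=
  \row_(i < d) ('D_(delta_mx ord0 i) f x).

(* Density of the isotropic Gaussian N(0, s^2 I) on R^d (s = standard deviation),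
   the product of the library's one-dimensional normal densities. *)
Definition gauss_pdfv {d} (s : R) (x : vec d) : R :=
  \prod_(i < d) normal_pdf 0 s (x ord0 i).

Local Open Scope ereal_scope.

(* Lebesgue integral of a nonnegative function on R^n, as the iterated
   one-dimensional Lebesgue integral over the coordinates (Tonelli). *)
Fixpoint iint (n : nat) (f : seq R -> \bar R) : \bar R :=
  match n with
  | 0 => f [::]
  | n'.+1 => \int[@lebesgue_measure R]_x iint n' (fun s => f (x :: s))
  end.

Definition intRd (d : nat) (f : vec d -> \bar R) : \bar R :=
  iint d (fun s => f (\row_(i < d) nth 0%R s i)).

Definition intRd2 (d : nat) (f : vec d * vec d -> \bar R) : \bar R :=
  intRd (fun th => intRd (fun r => f (th, r))).

Local Close Scope ereal_scope.

Section transition.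
Context {d : nat} {dS : measure_display} {S : measurableType dS}.
Variables (eps sigma beta : R).
(* gU s = gradient of the random energy component indexed by s *)
Variable gU : S -> vec d -> vec d.

(* Inner loop, steps t = 0..T-1.  Input: current position (theta_0 at the
   first step, theta_{t-1} afterwards), r_{t-1/2}, rho_{t-1/2}, and the list of
   (eta_t, s_t) for the remaining steps.  Output: (theta_{T-1}, r_{T-1/2},
   rho_{T-1/2}). *)
Fixpoint amagold_loop (first : bool) (th r : vec d) (rho : R)
    (l : seq (vec d * S)) : vec d * vec d * R :=
  match l with
  | [::] => (th, r, rho)
  | (eta, s) :: l' =>
      let tht := if first then th else th + (eps / sigma ^+ 2) *: r in
      let g := gU s tht in
      let r' := (1 + eps * beta)^-1 *: ((1 - eps * beta) *: r - eps *: g + eta) in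
      let rho' := rho + (eps / (2 * sigma ^+ 2)) * dotv g (r + r') in
      amagold_loop false tht r' rho' l'
  end.

Definition amagold_proposal (th r : vec d) (l : seq (vec d * S))
    : vec d * vec d * R :=
  let: (th', r', rho) :=
    amagold_loop true (th + (eps / (2 * sigma ^+ 2)) *: r) r 0 l in
  (th' + (eps / (2 * sigma ^+ 2)) *: r', r', rho).

Local Open Scope ereal_scope.

(* Expectation over the noise of one transition: for t = 0..T-1 (in order),
   eta_t ~ N(0, 4 eps beta sigma^2 I) and s_t ~ mu, all independent. *)
Fixpoint noiseE (mu : probability S R) (n : nat)
    (F : seq (vec d * S) -> \bar R) : \bar R :=
  match n with
  | 0 => F [::]
  | n'.+1 =>
      \int[mu]_s intRd (fun eta : vec d =>
         (gauss_pdfv (Num.sqrt (4 * eps * beta * sigma ^+ 2)) eta)%:E *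
         noiseE mu n' (fun l => F ((eta, s) :: l)))
  end.

Definition amagold_kernel (mu : probability S R) (T : nat)
    (Theta : set (vec d)) (U : vec d -> R)
    (x : vec d * vec d) (B : set (vec d * vec d)) : \bar R :=
  noiseE mu T (fun l =>
    let: (ths, rs, rho) := amagold_proposal x.1 x.2 l in
    let acc : R := (if ths \in Theta
                    then Num.min 1 (expR (U x.1 - U ths + rho)) else 0)%R in
    (acc * \1_B (ths, rs) + (1 - acc) * \1_B (x.1, - x.2))%R%:E).

Definition amagold_kernel_resample (mu : probability S R) (T : nat)
    (Theta : set (vec d)) (U : vec d -> R)
    (th : vec d) (A : set (vec d)) : \bar R :=
  intRd (fun r : vec d => (gauss_pdfv sigma r)%:E *
          amagold_kernel mu T Theta U (th, r) (A `*` setT)).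

End transition.

Local Open Scope ereal_scope.

Definition Z_theta {d} (Theta : set (vec d)) (U : vec d -> R) : \bar R :=
  intRd (fun th => (\1_Theta th * expR (- U th))%:E).

Definition pi_theta {d} (Theta : set (vec d)) (U : vec d -> R) (th : vec d) : R :=
  (\1_Theta th * expR (- U th) / fine (Z_theta Theta U))%R.

Definition joint_unnorm {d} (Theta : set (vec d)) (U : vec d -> R) (sigma : R)
    (x : vec d * vec d) : R :=
  (\1_Theta x.1 * expR (- U x.1 - (2 * sigma ^+ 2)^-1 * sqnormv x.2))%R.

Definition Z_joint {d} (Theta : set (vec d)) (U : vec d -> R) (sigma : R) : \bar R :=
  intRd2 (fun x => (joint_unnorm Theta U sigma x)%:E).

Definition pi_joint {d} (Theta : set (vec d)) (U : vec d -> R) (sigma : R)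
    (x : vec d * vec d) : R :=
  (joint_unnorm Theta U sigma x / fine (Z_joint Theta U sigma))%R.

Definition perp {d} (x : vec d * vec d) : vec d * vec d := (x.1, (- x.2)%R).

End amagold.

(* Main.v *)
(* Carry the energy error rho along as a third coordinate of the state, and give
   (theta, r, rho) the measure exp(-|r|^2/(2 sigma^2) - rho) dtheta dr drho.  For
   this measure each position drift and each noisy momentum update ("kick") is
   skew-reversible with respect to r |-> -r: for the kick the Gaussian density of
   the noise satisfies detailed balance up to exp of the increment of rho.  The
   adjoint of a product is the product of the adjoints in reverse order, and one
   trajectory, half drift, kick, (drift, kick)^(T-1), half drift, is a
   palindrome, hence skew-reversible itself.
   The Metropolis test is then recovered by writing
   min(exp(-a), exp(-b)) as the integral of exp(-t) over {t >= a, t >= b}: with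
   rho started at t, accepting means that rho lies above U at both ends of the
   trajectory, a condition symmetric under time reversal.  The rejected mass is
   symmetric pointwise. *)

Require Import Defs.
From HB Require Import structures.
From mathcomp Require Import all_boot all_order all_algebra.
From mathcomp Require Import all_classical all_reals all_analysis.
From mathcomp Require Import measurable_realfun ring lra.
Import Order.TTheory GRing.Theory Num.Theory.
Import numFieldNormedType.Exports.
Local Open Scope classical_set_scope.
Local Open Scope ring_scope.

(** * Measurability on row vectors *)

Section rV_measurable.
Context {dX dT : measure_display} {X : measurableType dX} {V : measurableType dT}.

Lemma measurable_rV_coord n (i : 'I_n) :
  measurable_fun setT (fun x : 'rV[V]_n => x ord0 i).
Proof.
move=> _ Y mY; rewrite setTI; apply: sub_sigma_algebra => /=.
rewrite -bigcup_seq/=; exists i => /=; first by rewrite mem_index_enum.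
by exists Y => //; rewrite setTI.
Qed.

(** The preimage under [f] of a generated sigma-algebra is generated by the preimages of the
    generators, here by the coordinates of [f]. *)
Lemma measurable_rVP n (f : X -> 'rV[V]_n) :
  (forall i, measurable_fun setT (fun x => f x ord0 i)) -> measurable_fun setT f.
Proof.
move=> mf.
have : g_sigma_preimage (fun i => (fun x : 'rV[V]_n => x ord0 i) \o f)
    `<=` measurable.
  apply: smallest_sub; first exact: sigma_algebra_measurable.
  rewrite -bigcup_seq; apply: bigcup_sub => i Ii.
  by move=> A [B mB <-]; exact: mf.
by rewrite g_sigma_preimage_comp => prefS _ A mA; apply: prefS; exists A.
Qed.

End rV_measurable.

Section rV_measurable_ops.
Context {R : realType} {dX : measure_display} {X : measurableType dX}.

Lemma measurable_addv n (f g : X -> 'rV[R]_n) :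
  measurable_fun setT f -> measurable_fun setT g ->
  measurable_fun setT (fun x => f x + g x).
Proof.
move=> mf mg; apply: measurable_rVP => i; under eq_fun do rewrite mxE.
by apply: measurable_funD; [exact: (measurableT_comp (measurable_rV_coord _ i) mf)
  |exact: (measurableT_comp (measurable_rV_coord _ i) mg)].
Qed.

Lemma measurable_scalev n (c : R) (f : X -> 'rV[R]_n) :
  measurable_fun setT f -> measurable_fun setT (fun x => c *: f x).
Proof.
move=> mf; apply: measurable_rVP => i; under eq_fun do rewrite mxE.
by apply: measurable_funM => //; exact: (measurableT_comp (measurable_rV_coord _ i) mf).
Qed.

Lemma measurable_oppv n (f : X -> 'rV[R]_n) :
  measurable_fun setT f -> measurable_fun setT (fun x => - f x).
Proof.
move=> mf; under eq_fun do rewrite -scaleN1r; exact: measurable_scalev.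
Qed.

Lemma measurable_dotv n (f g : X -> 'rV[R]_n) :
  measurable_fun setT f -> measurable_fun setT g ->
  measurable_fun setT (fun x => dotv (f x) (g x)).
Proof.
move=> mf mg; apply: measurable_sum => i; apply: measurable_funM.
- exact: (measurableT_comp (measurable_rV_coord _ i) mf).
- exact: (measurableT_comp (measurable_rV_coord _ i) mg).
Qed.

Lemma measurable_gauss_pdfv n (s : R) (f : X -> 'rV[R]_n) :
  measurable_fun setT f -> measurable_fun setT (fun x => gauss_pdfv s (f x)).
Proof.
move=> mf; apply: measurable_prod => i _.
apply: (measurableT_comp (measurable_normal_pdf 0 s)).
exact: (measurableT_comp (measurable_rV_coord _ i) mf).
Qed.

End rV_measurable_ops.

(** * Borel measurability of continuous functions *)

Section continuous_rV.
Context {R : realType}.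

Lemma measurable_floor_fiber (z : int) : measurable [set x : R | Num.floor x = z].
Proof.
have -> : [set x : R | Num.floor x = z] = `[z%:~R, (z + 1)%:~R[%classic.
  apply/seteqP; split=> x /=; rewrite in_itv/=.
    by move=> <-; rewrite floor_le floorD1_gt.
  by move=> ?; apply: floor_def.
exact: measurable_itv.
Qed.

(* A continuous function is the pointwise limit of its values at the points of
   the grids (1/(k+1)) Z^n. *)
Lemma continuous_rV_measurable n (f : 'rV[R]_n -> R) :
  continuous f -> measurable_fun setT f.
Proof.
move=> cf.
pose q k (x : 'rV[R]_n) : 'rV[int]_n := \row_i Num.floor (k.+1%:R * x ord0 i).
pose p k (z : 'rV[int]_n) : 'rV[R]_n := \row_i ((z ord0 i)%:~R / k.+1%:R).
apply: (@measurable_fun_cvg _ _ _ _ (fun k x => f (p k (q k x)))) => //.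
  move=> k _ Y mY; rewrite setTI.
  (* There are countably many grid indices [z], and each fibre of [q k] is a finite intersection of
     conditions on floors. *)
  have -> : (fun x => f (p k (q k x))) @^-1` Y =
     \bigcup_z (if z \in [set z | Y (f (p k z))] then q k @^-1` [set z] else set0).
    apply/seteqP; split => [x Yx|x [z _]]; first by exists (q k x) => //; rewrite mem_set.
    by case: ifPn => // /[1!inE] Yz /= qz; rewrite /preimage/= qz.
  apply: countable_bigcupT_measurable => [|z]; first exact: countableP.
  case: ifPn => // _.
  have -> : q k @^-1` [set z] = \bigcap_(i in [set: 'I_n])
     [set x | Num.floor (k.+1%:R * x ord0 i) = z ord0 i].
    apply/seteqP; split => [x /= <- i _ /=|x /= H]; first by rewrite mxE.
    by apply/rowP => i; rewrite mxE H.
  apply: fin_bigcap_measurable => [|i _]; first exact: finite_finset.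
  rewrite -[X in measurable X]setTI.
  have mk : measurable_fun setT (fun x : 'rV[R]_n => k.+1%:R * x ord0 i).
    by apply: measurable_funM => //; exact: measurable_rV_coord.
  exact: mk (measurable_floor_fiber _).
(* Each coordinate of [p k (q k x)] is within 1/(k+1) of that of [x]. *)
move=> x _; apply: (continuous_cvg _ (cf x)).
apply/cvg_ballP => e e0.
near=> k.
have ke : k.+1%:R^-1 < e by near: k; exact: (near_infty_natSinv_lt (PosNum e0)).
split => // i j; rewrite !mxE ord1.
rewrite /ball/= distrC.
set y := x ord0 j; set N : R := k.+1%:R.
have N0 : 0 < N by rewrite ltr0n.
have -> : (Num.floor (N * y))%:~R / N - y = ((Num.floor (N * y))%:~R - N * y) / N.
  by field; rewrite gt_eqF.
rewrite normrM ler0_norm; last by rewrite subr_le0 floor_le.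
rewrite gtr0_norm ?invr_gt0// ltr_pdivrMr//.
rewrite (@le_lt_trans _ _ 1)//.
  have := floorD1_gt (N * y); rewrite intrD; lra.
by rewrite mulrC -ltr_pdivrMl ?mulr1.
Unshelve. all: by end_near. Qed.
End continuous_rV.

(** * Lebesgue measure on row vectors *)

Section mnn.
Context {R : realType}.
Local Open Scope ereal_scope.

(** The class on which Tonelli, linearity and changes of variables hold with values in [0, +oo], so
    that integrability never has to be discussed. *)
Definition mnn {d} {X : measurableType d} (f : X -> \bar R) :=
  measurable_fun setT f /\ forall x, 0 <= f x.

Context {dX dY : measure_display}.
Context {X : measurableType dX} {Y : measurableType dY}.

Lemma mnn_integral (m : {sigma_finite_measure set Y -> \bar R})
    (f : X * Y -> \bar R) : mnn f -> mnn (fun x => \int[m]_y f (x, y)).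
Proof.
move=> [mf f0]; split=> [|x]; first exact: measurable_fun_fubini_tonelli_F.
by apply: integral_ge0 => y _; exact: f0.
Qed.

End mnn.

Section transport.
Context {R : realType} {d1 d2 : measure_display}.
Context {T1 : measurableType d1} {T2 : measurableType d2}.
Local Open Scope ereal_scope.

(** The measure is the pushforward along [phi]. The left inverse [psi] pulls the exhaustion [F] back
    to sets whose pushforward mass is that of [F k], which keeps sigma-finiteness. *)
Lemma sigma_finite_transport (m : {measure set T1 -> \bar R})
    (phi : T1 -> T2) (psi : T2 -> T1) :
  sigma_finite setT m ->
  measurable_fun setT phi -> measurable_fun setT psi -> cancel phi psi ->
  exists m' : {sigma_finite_measure set T2 -> \bar R},
    forall f : T2 -> \bar R, mnn f -> \int[m']_x f x = \int[m]_x f (phi x).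
Proof.
move=> [F TF Foo] mphi mpsi phiK.
pose pm := @measure_function_pushforward__canonical__measure_function_Measure
  _ _ _ _ _ m phi mphi.
have sf : sigma_finite setT pm.
  exists (fun k => psi @^-1` F k); first by rewrite -preimage_bigcup -TF preimage_setT.
  move=> k; have [mFk Fk] := Foo k; split.
    by rewrite -[X in measurable X]setTI; exact: mpsi.
  have -> // : pm (psi @^-1` F k) = m (F k).
  rewrite /pm/= /pushforward; congr (m _).
  by apply/seteqP; split=> p; rewrite /preimage/= phiK.
pose pmS : {sigma_finite_measure set T2 -> \bar R} :=
  HB.pack (Measure.sort pm) (Measure_isSigmaFinite.Build _ _ _ pm sf).
exists pmS => f [mf f0].
by rewrite (ge0_integral_pushforward mphi)// preimage_setT.
Qed.

Lemma sigma_finite_prod (m1 : {sigma_finite_measure set T1 -> \bar R})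
    (m2 : {sigma_finite_measure set T2 -> \bar R}) : sigma_finite setT (m1 \x m2).
Proof.
(* Both exhaustions are taken nondecreasing, so that a point caught at indices [j] and [k] is caught
   by the product of index [maxn j k]. *)
have /sigma_finiteP[F [TF ndF Foo]] := sigma_finiteT m1.
have /sigma_finiteP[G [TG ndG Goo]] := sigma_finiteT m2.
exists (fun k => F k `*` G k).
  apply/seteqP; split=> // -[x y] _.
  have : setT x by []. have : setT y by [].
  rewrite [in X in X -> _]TG [in X in _ -> X -> _]TF => -[k _ Gk] [j _ Fj].
  exists (maxn j k) => //; split.
  - by move/subsetPset : (ndF _ _ (leq_maxl j k)); exact.
  - by move/subsetPset : (ndG _ _ (leq_maxr j k)); exact.
move=> k; have [mFk Fk] := Foo k; have [mGk Gk] := Goo k.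
split; first exact: measurableX.
by rewrite product_measure1E// lte_mul_pinfty// ge0_fin_numE.
Qed.

End transport.

Lemma measurable_expR_comp {R : realType} {d} {X : measurableType d} (f : X -> R) :
  measurable_fun setT f -> measurable_fun setT (fun x => expR (f x)).
Proof. by move=> mf; exact: (measurableT_comp (@measurable_expR R) mf). Qed.

Lemma measurable_natb {R : realType} {d} {X : measurableType d} (b : X -> bool) :
  measurable_fun setT b -> measurable_fun setT (fun x => (b x)%:R : R).
Proof.
move=> mb; rewrite [X in measurable_fun _ X](_ : _ = fun x => if b x then 1 else 0).
  by apply: measurable_fun_ifT => //; exact: measurable_cst.
by apply/funext => x; case: (b x).
Qed.

Section lebesgue_rV.
Context {R : realType}.
Local Open Scope ereal_scope.

Definition consv n (x : R) (v : 'rV[R]_n) : 'rV[R]_n.+1 :=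
  \row_i (if unlift ord0 i is Some j then v ord0 j else x).

Lemma measurable_consv n :
  measurable_fun setT (fun p : R * 'rV[R]_n => consv n p.1 p.2).
Proof.
apply: measurable_rVP => i; under eq_fun do rewrite mxE.
case: (unlift ord0 i) => [j|]; last exact: measurable_fst.
exact: (measurableT_comp (measurable_rV_coord _ j) measurable_snd).
Qed.

Definition unconsv n (v : 'rV[R]_n.+1) : R * 'rV[R]_n :=
  (v ord0 ord0, \row_j v ord0 (lift ord0 j)).

Lemma measurable_unconsv n : measurable_fun setT (unconsv n).
Proof.
apply: measurable_fun_pair; first exact: measurable_rV_coord.
apply: measurable_rVP => i; under eq_fun do rewrite mxE.
exact: measurable_rV_coord.
Qed.

Lemma consvK n : cancel (fun p : R * 'rV[R]_n => consv n p.1 p.2) (unconsv n).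
Proof.
move=> [x v]; congr (_, _); first by rewrite mxE unlift_none.
by apply/rowP => j; rewrite !mxE liftK.
Qed.

Lemma intRd0 (f : 'rV[R]_0 -> \bar R) : intRd f = f 0%R.
Proof. by rewrite /intRd /=; congr f; apply/rowP => -[]. Qed.

Lemma intRdS n (f : 'rV[R]_n.+1 -> \bar R) :
  intRd f = \int[@lebesgue_measure R]_x intRd (fun v => f (consv n x v)).
Proof.
rewrite /intRd /=; apply: eq_integral => x _; congr iint; apply/funext => s.
congr f; apply/rowP => i; rewrite !mxE; case: unliftP => [j ->|->] //=.
by rewrite mxE.
Qed.

(** Represents the iterated integral by one sigma-finite measure, which opens the way to Tonelli
    between vector variables. By induction: a Dirac mass in dimension 0, then the image under
    [consv] of the product with one-dimensional Lebesgue measure. *)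
Lemma lebesgue_rV_exists n : exists m : {sigma_finite_measure set 'rV[R]_n -> \bar R},
  forall f : 'rV[R]_n -> \bar R, mnn f -> intRd f = \int[m]_x f x.
Proof.
elim: n => [|n [m IH]].
  exists (\d_(0%R : 'rV[R]_0)) => f [mf f0].
  by rewrite intRd0 integral_dirac// diracT mul1e.
have [m' m'E] := sigma_finite_transport _ _ _
  (sigma_finite_prod (@lebesgue_measure R) m)
  (@measurable_consv n) (@measurable_unconsv n) (@consvK n).
exists m' => f mf; rewrite intRdS m'E// fubini_tonelli1//=; first last.
- by move=> x; exact: mf.2.
- exact: (measurableT_comp mf.1 (@measurable_consv n)).
apply: eq_integral => x _; apply: IH.
split=> [|v]; last exact: mf.2.
have mfphi := measurableT_comp mf.1 (@measurable_consv n).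
exact: (measurableT_comp mfphi (pair1_measurable x)).
Qed.

Definition leb n : {sigma_finite_measure set 'rV[R]_n -> \bar R} :=
  projT1 (cid (lebesgue_rV_exists n)).

Lemma intRdE n (f : 'rV[R]_n -> \bar R) : mnn f -> intRd f = \int[leb n]_x f x.
Proof. exact: (projT2 (cid (lebesgue_rV_exists n))). Qed.

(** By uniqueness of Lebesgue measure: [|c|] times the image of Lebesgue measure under x -> cx + a
    gives every half-open interval its length. *)
Lemma integral_affine (c a : R) (f : R -> \bar R) : (c != 0)%R -> mnn f ->
  \int[@lebesgue_measure R]_x f x =
  \int[@lebesgue_measure R]_x ((`|c|)%:E * f (c * x + a)%R).
Proof.
move=> c0 [mf f0].
pose phi (x : measurableTypeR R) : measurableTypeR R := (c * x + a)%R.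
have mphi : measurable_fun setT phi.
  by apply: measurable_funD => //; exact: mulrl_measurable.
pose pm := @measure_function_pushforward__canonical__measure_function_Measure
  _ _ _ _ _ (@lebesgue_measure R) phi mphi.
(* A negative [c] swaps the endpoints, and the preimage becomes closed on the left. *)
have phiE x y : phi @^-1` `]x, y] = if (0 < c)%R
    then `]((x - a) / c)%R, ((y - a) / c)%R]%classic
    else `[((y - a) / c)%R, ((x - a) / c)%R[%classic.
  apply/seteqP; split => z; rewrite /preimage/= /phi in_itv/=;
    (case: ifPn; rewrite -?leNgt => cs; first (rewrite /= in_itv/= ltr_pdivrMr//
     ler_pdivlMr//; lra)); have {}cs : (c < 0)%R by [rewrite lt_neqAle c0];
  rewrite /= in_itv/= ler_ndivrMr// ltr_ndivlMr//; lra.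
transitivity (\int[mscale (NngNum (normr_ge0 c)) pm]_x f x).
  apply: eq_measure_integral => A mA _.
  apply: lebesgue_measure_unique => // _ [[x y]] _ <-.
  rewrite -[RHS]/((`|c|)%:E * lebesgue_measure (phi @^-1` `]x, y])) phiE.
  case: ifPn; rewrite -?leNgt => cs.
    rewrite !lebesgue_measure_itv/= !lte_fin ltr_pdivrMr// divfK// ltrD2r.
    case: ifPn => _; last by rewrite mule0.
    rewrite gtr0_norm// -!EFinB -EFinM; congr (_%:E); field.
    by rewrite gt_eqF.
  have {}cs : (c < 0)%R by rewrite lt_neqAle c0.
  rewrite !lebesgue_measure_itv/= !lte_fin ltr_ndivrMr// divfK// ltrD2r.
  case: ifPn => _; last by rewrite mule0.
  rewrite ltr0_norm// -!EFinB -EFinM; congr (_%:E); field.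
  by rewrite lt_eqF.
rewrite ge0_integral_mscale//= ge0_integral_pushforward// preimage_setT.
rewrite -ge0_integralZl//; last by move=> ? _; exact: f0.
exact: (measurableT_comp mf mphi).
Qed.

Lemma intRdZl n (k : \bar R) (f : 'rV[R]_n -> \bar R) : 0 <= k -> mnn f ->
  intRd (fun x => k * f x) = k * intRd f.
Proof.
move=> k0 [mf f0]; rewrite !intRdE ?ge0_integralZl//; split => //.
  exact: measurable_funeM.
by move=> x; rewrite mule_ge0.
Qed.

Lemma mnn_intRd d (X : measurableType d) n (f : X * 'rV[R]_n -> \bar R) :
  mnn f -> mnn (fun x => intRd (fun v => f (x, v))).
Proof.
move=> mf; rewrite [X in mnn X](_ : _ = fun x => \int[leb n]_v f (x, v)).
  exact: mnn_integral.
apply/funext => x; rewrite intRdE//; split=> [|v]; last exact: mf.2.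
exact: (measurableT_comp mf.1 (pair1_measurable x)).
Qed.

(** The scalar rule is applied one coordinate at a time; each contributes one factor [|c|]. *)
Lemma intRd_affine n (c : R) (a : 'rV[R]_n) (f : 'rV[R]_n -> \bar R) :
  (c != 0)%R -> mnn f ->
  intRd f = intRd (fun x => (`|c| ^+ n)%:E * f (c *: x + a)%R).
Proof.
move=> c0; elim: n a f => [|n IH] a f mf.
  by rewrite !intRd0 expr0 mul1e; congr f; apply/rowP => -[].
have mfphi := measurableT_comp mf.1 (@measurable_consv n).
have mnnv x : mnn (fun v => f (consv n x v)).
  by split=> [|v]; [exact: (measurableT_comp mfphi (pair1_measurable x))|exact: mf.2].
rewrite !intRdS (integral_affine c (a ord0 ord0))//; last first.
  apply: (mnn_intRd _ _ n (fun p => f (consv n p.1 p.2))).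
  by split=> // p; exact: mf.2.
apply: eq_integral => x _.
rewrite (IH (\row_j a ord0 (lift ord0 j)))// -intRdZl//.
  congr intRd; apply/funext => v; rewrite muleA -EFinM -exprS; congr (_ * f _).
  apply/rowP => i; rewrite !mxE; case: unliftP => [j ->|->] //=.
  by rewrite !mxE.
split=> [|v]; last by rewrite mule_ge0 ?lee_fin ?exprn_ge0//; exact: mf.2.
apply: measurable_funeM; apply: (measurableT_comp (mnnv _).1).
by apply: measurable_addv => //; exact: measurable_scalev.
Qed.

Lemma integral_leb_affine n (c : R) (a : 'rV[R]_n) (f : 'rV[R]_n -> \bar R) :
  (c != 0)%R -> mnn f ->
  \int[leb n]_x f x = (`|c| ^+ n)%:E * \int[leb n]_x f (c *: x + a)%R.
Proof.
move=> c0 mf; rewrite -intRdE// (intRd_affine _ c a)//.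
have mg : mnn (fun x : 'rV[R]_n => f (c *: x + a)%R).
  split=> [|x]; last exact: mf.2.
  apply: (measurableT_comp mf.1); apply: measurable_addv => //.
  exact: measurable_scalev.
by rewrite intRdZl// ?lee_fin ?exprn_ge0// intRdE.
Qed.

Lemma integral_leb_opp n (f : 'rV[R]_n -> \bar R) : mnn f ->
  \int[leb n]_x f x = \int[leb n]_x f (- x)%R.
Proof.
move=> mf; rewrite (integral_leb_affine _ (-1) 0)// ?oppr_eq0 ?oner_eq0//.
rewrite normrN1 expr1n mul1e; apply: eq_integral => x _.
by rewrite scaleN1r addr0.
Qed.

Lemma integral_leb_shift n (a : 'rV[R]_n) (f : 'rV[R]_n -> \bar R) : mnn f ->
  \int[leb n]_x f x = \int[leb n]_x f (x + a)%R.
Proof.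
move=> mf; rewrite (integral_leb_affine _ 1 a)// ?oner_eq0//.
by rewrite normr1 expr1n mul1e; apply: eq_integral => x _; rewrite scale1r.
Qed.

Lemma lebesgue_R_exists : exists m : {sigma_finite_measure set R -> \bar R},
  forall f : R -> \bar R, mnn f -> \int[m]_x f x = \int[@lebesgue_measure R]_x f x.
Proof.
apply: (@sigma_finite_transport R _ _ (measurableTypeR R) R lebesgue_measure
  (fun x => x) (fun x => x)) => //.
exact: (sigma_finiteT [the {sigma_finite_measure set _ -> \bar R} of @lebesgue_measure R]).
Qed.

(* Same as lebesgue_measure, but on the canonical measurable structure of R:
   the display of measurableTypeR R differs from that of R, which blocks the use
   of lebesgue_measure in products. *)
Definition lebR : {sigma_finite_measure set R -> \bar R} :=
  projT1 (cid lebesgue_R_exists).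

Lemma lebRE (f : R -> \bar R) : mnn f ->
  \int[lebR]_x f x = \int[@lebesgue_measure R]_x f x.
Proof. exact: (projT2 (cid lebesgue_R_exists)). Qed.

Lemma integral_shift (a : R) (f : R -> \bar R) : mnn f ->
  \int[lebR]_x f x = \int[lebR]_x f (x + a)%R.
Proof.
move=> mf; have mg : mnn (fun x : R => f (x + a)%R).
  split=> [|x]; last exact: mf.2.
  by apply: (measurableT_comp mf.1); exact: measurable_funD.
rewrite !lebRE// (integral_affine 1 a)// ?oner_eq0//.
by apply: eq_integral => x _; rewrite normr1 mul1e mul1r.
Qed.

Lemma integral_gauss_pdfv n (s : R) : \int[leb n]_x (gauss_pdfv s x)%:E = 1.
Proof.
have g0 k (x : 'rV[R]_k) : (0 <= gauss_pdfv s x)%R.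
  by apply: prodr_ge0 => i _; exact: normal_pdf_ge0.
have mg k : mnn (fun x : 'rV[R]_k => (gauss_pdfv s x)%:E).
  split=> [|x]; last by rewrite lee_fin.
  by apply/measurable_EFinP; exact: measurable_gauss_pdfv.
rewrite -intRdE//; elim: n => [|n IH]; first by rewrite intRd0 /gauss_pdfv big_ord0.
rewrite intRdS -[RHS](integral_normal_pdf 0 s); apply: eq_integral => x _.
rewrite -[RHS]mule1 -IH -intRdZl// ?lee_fin ?normal_pdf_ge0//.
congr intRd; apply/funext => v; rewrite /gauss_pdfv big_ord_recl -EFinM mxE.
rewrite unlift_none; congr (_ * _)%:E; apply: eq_bigr => i _.
by rewrite mxE liftK.
Qed.

(** After a shift by [c] the integrand is exp(-c) times the exponential density of rate 1. *)
Lemma integral_expR_tail (c : R) :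
  \int[lebR]_t (expR (- t) * (c <= t)%R%:R)%:E = (expR (- c))%:E.
Proof.
have mh : mnn (fun t : R => (expR (- t) * (c <= t)%R%:R)%:E).
  split=> [|t]; last by rewrite lee_fin mulr_ge0 ?expR_ge0.
  apply/measurable_EFinP; apply: measurable_funM.
    by apply: measurable_expR_comp; exact: measurable_funN.
  by apply: measurable_natb; exact: measurable_fun_ler.
rewrite lebRE// (integral_affine 1 c)// ?oner_eq0//.
transitivity (\int[@lebesgue_measure R]_x
    ((expR (- c))%:E * (exponential_pdf 1 x)%:E)).
  apply: eq_integral => x _; rewrite normr1 mul1e mul1r lerDr -EFinM; congr _%:E.
  have [x0|x0] := leP 0%R x.
    by rewrite exponential_pdfE// opprD expRD mul1r mulN1r mulr1 mulrC.
  by rewrite lt0_exponential_pdf// !mulr0.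
rewrite ge0_integralZl//.
- by rewrite integral_exponential_pdf// mule1.
- by apply/measurable_EFinP; exact: measurable_exponential_pdf.
- by move=> x _; rewrite lee_fin exponential_pdf_ge0.
Qed.

End lebesgue_rV.

(** * Calculus of nonnegative measurable functions *)

Section mnn_closure.
Context {R : realType} {dX dY : measure_display}.
Context {X : measurableType dX} {Y : measurableType dY}.
Local Open Scope ereal_scope.

Lemma mnn_mule (f g : X -> \bar R) : mnn f -> mnn g -> mnn (fun x => f x * g x).
Proof.
move=> [mf f0] [mg g0]; split=> [|x]; first exact: emeasurable_funM.
exact: mule_ge0.
Qed.

Lemma mnn_adde (f g : X -> \bar R) : mnn f -> mnn g -> mnn (fun x => f x + g x).
Proof.
move=> [mf f0] [mg g0]; split=> [|x]; first exact: emeasurable_funD.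
exact: adde_ge0.
Qed.

Lemma mnn_EFin (f : X -> R) : measurable_fun setT f -> (forall x, (0 <= f x)%R) ->
  mnn (fun x => (f x)%:E).
Proof. by move=> mf f0; split=> [|x]; [exact/measurable_EFinP|rewrite lee_fin]. Qed.

Lemma mnn_comp (F : Y -> \bar R) (g : X -> Y) :
  mnn F -> measurable_fun setT g -> mnn (fun x => F (g x)).
Proof. by move=> [mF F0] mg; split=> [|x //]; exact: measurableT_comp. Qed.

Lemma mnn_int (m : {sigma_finite_measure set Y -> \bar R}) (f : X -> Y -> \bar R) :
  mnn (fun p : X * Y => f p.1 p.2) -> mnn (fun x => \int[m]_y f x y).
Proof. exact: mnn_integral. Qed.

Lemma tonelli (m1 : {sigma_finite_measure set X -> \bar R})
    (m2 : {sigma_finite_measure set Y -> \bar R}) (f : X -> Y -> \bar R) :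
  mnn (fun p : X * Y => f p.1 p.2) ->
  \int[m1]_x \int[m2]_y f x y = \int[m2]_y \int[m1]_x f x y.
Proof. by move=> [mf f0]; rewrite (fubini_tonelli _ mf). Qed.

Lemma mnn_integralZl (m : {measure set X -> \bar R}) (k : \bar R) (f : X -> \bar R) :
  0 <= k -> mnn f -> \int[m]_x (k * f x) = k * \int[m]_x f x.
Proof. by move=> k0 [mf f0]; rewrite ge0_integralZl. Qed.

Lemma mnn_integralD (m : {measure set X -> \bar R}) (f g : X -> \bar R) :
  mnn f -> mnn g -> \int[m]_x (f x + g x) = \int[m]_x f x + \int[m]_x g x.
Proof. by move=> [mf f0] [mg g0]; rewrite ge0_integralD. Qed.

End mnn_closure.

(** * Automation of measurability goals *)

Section measurable_forms.
Context {dX dY dZ : measure_display} {X : measurableType dX}.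
Context {Y : measurableType dY} {Z : measurableType dZ}.

Lemma measurable_fst_comp (f : X -> Y * Z) :
  measurable_fun setT f -> measurable_fun setT (fun x => (f x).1).
Proof. by move=> mf; exact: (measurableT_comp measurable_fst mf). Qed.

Lemma measurable_snd_comp (f : X -> Y * Z) :
  measurable_fun setT f -> measurable_fun setT (fun x => (f x).2).
Proof. by move=> mf; exact: (measurableT_comp measurable_snd mf). Qed.

Lemma measurable_compose (g : Y -> Z) (f : X -> Y) :
  measurable_fun setT g -> measurable_fun setT f -> measurable_fun setT (fun x => g (f x)).
Proof. by move=> mg mf; exact: measurableT_comp. Qed.

Lemma measurable_indic_comp (R : realType) (A : set Y) (f : X -> Y) : measurable A ->
  measurable_fun setT f -> measurable_fun setT (fun x => \1_A (f x) : R).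
Proof.
move=> mA mf; have m1 : measurable_fun setT (\1_A : Y -> R) by exact: measurable_indic.
exact: (measurableT_comp m1 mf).
Qed.

End measurable_forms.

Section measurable_gU.
Context {R : realType} {d : nat} {dS dX : measure_display}.
Context {S : measurableType dS} {X : measurableType dX}.
Lemma measurable_comp2 (g : S -> 'rV[R]_d -> 'rV[R]_d) (s : X -> S) (th : X -> 'rV[R]_d) :
  measurable_fun setT (fun p : S * 'rV[R]_d => g p.1 p.2) ->
  measurable_fun setT s -> measurable_fun setT th ->
  measurable_fun setT (fun x => g (s x) (th x)).
Proof.
move=> mg ms mth.
exact: (measurableT_comp mg (measurable_fun_pair ms mth)).
Qed.
End measurable_gU.

Ltac meas := solve [repeat first
  [ assumption
  | solve [apply: measurable_cst]
  | exact: oppr_measurable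
  | exact: measurableT
  | lazymatch goal with
    | |- measurable_fun _ (fun x => x) => exact: measurable_id
    | |- measurable_fun _ fst => exact: measurable_fst
    | |- measurable_fun _ snd => exact: measurable_snd
    | |- measurable_fun _ (fun x => pair (@?a x) (@?b x)) => apply: measurable_fun_pair
    | |- measurable_fun _ (fun x => fst (@?a x)) => apply: measurable_fst_comp
    | |- measurable_fun _ (fun x => snd (@?a x)) => apply: measurable_snd_comp
    | |- measurable_fun _ (fun x => dotv (@?a x) (@?b x)) => apply: measurable_dotv
    | |- measurable_fun _ (fun x => sqnormv (@?a x)) => apply: measurable_dotv
    | |- measurable_fun _ (fun x => \1_(?A) (@?a x)) => apply: measurable_indic_comp
    | |- measurable_fun _ (fun x => gauss_pdfv ?s (@?a x)) => apply: measurable_gauss_pdfv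
    | |- measurable_fun _ (fun x => expR (@?a x)) => apply: measurable_expR_comp
    | |- measurable_fun _ (fun x => ?k *: (@?a x))%R => apply: measurable_scalev
    | |- measurable_fun _ (fun x => (@?a x) * (@?b x))%R => apply: measurable_funM
    | |- measurable_fun _ (fun x => ((@?a x)%:R))%R => apply: measurable_natb
    | |- measurable_fun _ (fun x => (@?a x) <= (@?b x))%R => apply: measurable_fun_ler
    | |- measurable_fun _ (fun x => (@?a x) + (@?b x))%R =>
       first [apply: measurable_addv | apply: measurable_funD]
    | |- measurable_fun _ (fun x => - (@?a x))%R =>
       first [apply: measurable_oppv | apply: measurable_funN]
    end
  | match goal with
    | H : measurable_fun _ (fun p => ?g p.1 p.2) |- measurable_fun _ (fun x => ?g (@?a x) (@?b x)) =>
      apply: (measurable_comp2 g)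
    | H : measurable_fun _ ?g |- measurable_fun _ (fun x => ?g (@?a x)) =>
      apply: (measurable_compose g)
    (* eta-reduced functions, such as the partial application r + _ *)
    | |- @measurable_fun _ _ ?T _ ?D (?h ?a) =>
        change (measurable_fun D (fun x : T => h a x));
        first [ apply: measurable_fun_pair | apply: measurable_addv | apply: measurable_scalev
              | apply: measurable_funD | apply: measurable_funM
              | apply: measurable_gauss_pdfv | apply: measurable_indic_comp ]
    end ] ].

(** * Drifts and kicks *)

Section gauss_balance.
Context {R : realType} {d : nat}.

Lemma gauss_pdfvE (s : R) (x : 'rV[R]_d) : s != 0 ->
  gauss_pdfv s x = normal_peak s ^+ d * expR (- (sqnormv x / (s ^+ 2 *+ 2))).
Proof.
move=> s0; rewrite /gauss_pdfv normal_pdfE// big_split/= prodr_const card_ord.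
congr (_ * _); rewrite -expR_sum; congr expR.
rewrite /sqnormv /dotv mulr_suml -sumrN; apply: eq_bigr => i _.
by rewrite subr0 mulNr expr2.
Qed.

(** Let A and A' be the noise vectors of the forward and the reversed kick, the arguments of the
    last [sqnormv] on each side. Then A - A' = 2eb(r + r') and A + A' = 2(r' - r + eg), so |A|^2 -
    |A'|^2 = 4eb(|r'|^2 - |r|^2 + e g.(r + r')). Division by twice the variance 4ebs^2 gives exactly
    the kinetic and work terms. *)
Lemma balance_exponent (e b s : R) (g r r' : 'rV[R]_d) : 0 < e -> 0 < b -> 0 < s ->
  - ((2 * s ^+ 2)^-1 * sqnormv r) + e / (2 * s ^+ 2) * dotv g (r + r') -
   sqnormv ((1 + e * b) *: r' - ((1 - e * b) *: r - e *: g)) / ((4 * e * b * s ^+ 2) *+ 2)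
  = - ((2 * s ^+ 2)^-1 * sqnormv r') -
   sqnormv ((1 + e * b) *: (- r) - ((1 - e * b) *: (- r') - e *: g)) / ((4 * e * b * s ^+ 2) *+ 2).
Proof.
move=> e0 b0 s0.
rewrite /sqnormv /dotv !mulr_suml !mulr_sumr -!sumrN -!big_split/=.
apply: eq_bigr => i _; rewrite !mxE; field.
by rewrite !gt_eqF.
Qed.

End gauss_balance.

Section operators.
Context {R : realType} {d : nat} {dS : measure_display} {S : measurableType dS}.
Variables (eps sigma beta : R) (mu : probability S R) (gU : S -> 'rV[R]_d -> 'rV[R]_d).
Hypothesis mgU : measurable_fun setT (fun p : S * 'rV[R]_d => gU p.1 p.2).
Hypotheses (eps0 : 0 < eps) (sigma0 : 0 < sigma) (beta0 : 0 < beta).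
Local Notation vec := 'rV[R]_d.
Local Notation Z := (vec * vec * R)%type.

Local Notation sd := (Num.sqrt (4 * eps * beta * sigma ^+ 2)).

Definition kick_mom (s : S) (th r eta : vec) : vec :=
  (1 + eps * beta)^-1 *: ((1 - eps * beta) *: r - eps *: gU s th + eta).

Definition kick_work (s : S) (th r r' : vec) : R :=
  eps / (2 * sigma ^+ 2) * dotv (gU s th) (r + r').

Definition kick_pt (s : S) (eta : vec) (z : Z) : Z :=
  (z.1.1, kick_mom s z.1.1 z.1.2 eta,
   z.2 + kick_work s z.1.1 z.1.2 (kick_mom s z.1.1 z.1.2 eta)).

Definition drift_pt (c : R) (z : Z) : Z := (z.1.1 + c *: z.1.2, z.1.2, z.2).

Definition flip_pt (z : Z) : Z := (z.1.1, - z.1.2, z.2).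

Definition weight (r : vec) (rho : R) : R :=
  expR (- ((2 * sigma ^+ 2)^-1 * sqnormv r) - rho).

(* Density of r_{t+1/2} given r_{t-1/2}. *)
Definition kick_dens (s : S) (th r r' : vec) : R :=
  (1 + eps * beta) ^+ d *
  gauss_pdfv sd ((1 + eps * beta) *: r' - ((1 - eps * beta) *: r - eps *: gU s th)).

Local Open Scope ereal_scope.

(** Moves are encoded as operators on test functions: a composition, read from the outside in, lists
    the moves in the order of time. *)
Definition kick (F : Z -> \bar R) (z : Z) : \bar R :=
  \int[mu]_s \int[leb d]_eta ((gauss_pdfv sd eta)%:E * F (kick_pt s eta z)).

Definition drift (c : R) (F : Z -> \bar R) (z : Z) : \bar R := F (drift_pt c z).

Definition flip (F : Z -> \bar R) (z : Z) : \bar R := F (flip_pt z).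

(** Positions carry plain Lebesgue measure here; [U] and [Theta] enter only through the test
    functions [slice]. *)
Definition pairing (F G : Z -> \bar R) : \bar R :=
  \int[leb d]_th \int[leb d]_r \int[lebR]_rho
    ((weight r rho)%:E * (F (th, r, rho) * G (th, r, rho))).

Lemma gauss_pdfv_ge0 n s (x : 'rV[R]_n) : (0 <= gauss_pdfv s x)%R.
Proof. by apply: prodr_ge0 => i _; exact: normal_pdf_ge0. Qed.

Lemma kick_dens_ge0 s th r r' : (0 <= kick_dens s th r r')%R.
Proof.
apply: mulr_ge0; last exact: gauss_pdfv_ge0.
by apply: exprn_ge0; rewrite addr_ge0// mulr_ge0// ltW.
Qed.

Lemma measurable_kick_pt dX (X : measurableType dX) (s : X -> S) (eta : X -> vec)
    (z : X -> Z) : measurable_fun setT s -> measurable_fun setT eta ->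
  measurable_fun setT z -> measurable_fun setT (fun x => kick_pt (s x) (eta x) (z x)).
Proof.
by move=> ms meta mz; rewrite /kick_pt /kick_work /kick_mom; meas.
Qed.

Ltac nneg := let x := fresh in move=> x;
  first [exact: gauss_pdfv_ge0 | exact: kick_dens_ge0 | exact: expR_ge0].

Ltac mn := solve [repeat first
  [ assumption
  | lazymatch goal with
    | |- mnn (fun x => mule (@?a x) (@?b x)) => apply: mnn_mule
    | |- mnn (fun x => EFin (@?a x)) =>
        apply: mnn_EFin; [rewrite /weight /kick_dens /kick_work /=; meas | nneg]
    | |- mnn (fun x => integral _ _ (@?f x)) => apply: mnn_int; cbv beta
    | |- measurable_fun _ (fun x => kick_pt (@?a x) (@?b x) (@?c x)) =>
        apply: measurable_kick_pt
    | |- measurable_fun _ _ =>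
        rewrite /drift_pt /flip_pt /kick_work /=; meas
    end
  | match goal with H : mnn ?F |- mnn (fun x => ?F (@?a x)) =>
      apply: (mnn_comp F) end ]].

(** Change of variables from the noise to the new momentum, with Jacobian (1 + eps beta)^d, the
    prefactor of [kick_dens]. *)
Lemma kickE (G : Z -> \bar R) th r rho : mnn G ->
  kick G (th, r, rho) = \int[mu]_s \int[leb d]_r'
    ((kick_dens s th r r')%:E * G (th, r', (rho + kick_work s th r r')%R)).
Proof.
move=> mG; apply: eq_integral => s _.
have b1 : (0 < 1 + eps * beta)%R by rewrite addr_gt0// mulr_gt0.
set u := ((1 - eps * beta) *: r - eps *: gU s th)%R.
have mK : mnn (fun eta : vec => (gauss_pdfv sd eta)%:E * G (kick_pt s eta (th, r, rho))).
  mn.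
rewrite (integral_leb_affine d (1 + eps * beta)%R (- u)%R)// ?gt_eqF//.
rewrite gtr0_norm// -mnn_integralZl.
- apply: eq_integral => r' _.
  rewrite muleA -EFinM; congr (_ * G _).
  rewrite /kick_pt/=.
  have -> : kick_mom s th r ((1 + eps * beta) *: r' - u)%R = r'.
    by rewrite /kick_mom -/u addrCA subrr addr0 scalerA mulVf ?scale1r// gt_eqF.
  by [].
- by rewrite lee_fin exprn_ge0// ltW.
- mn.
Qed.

(** Tonelli brings the integral over [rho] innermost, where the work is a constant and can be
    removed by a translation. *)
Lemma pairing_kickE (F G : Z -> \bar R) : mnn F -> mnn G ->
  pairing F (kick G) = \int[leb d]_th \int[mu]_s \int[leb d]_r \int[leb d]_r' \int[lebR]_rho
    ((weight r rho)%:E * (F (th, r, rho) * ((kick_dens s th r r')%:E *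
       G (th, r', (rho + kick_work s th r r')%R)))).
Proof.
move=> mF mG; apply: eq_integral => th _.
transitivity (\int[leb d]_r \int[mu]_s \int[leb d]_r' \int[lebR]_rho
    ((weight r rho)%:E * (F (th, r, rho) * ((kick_dens s th r r')%:E *
       G (th, r', (rho + kick_work s th r r')%R))))).
  apply: eq_integral => r _.
  transitivity (\int[lebR]_rho \int[mu]_s \int[leb d]_r'
    ((weight r rho)%:E * (F (th, r, rho) * ((kick_dens s th r r')%:E *
       G (th, r', (rho + kick_work s th r r')%R))))).
    apply: eq_integral => rho _; rewrite kickE// -mnn_integralZl; last 2 first.
    - exact: mF.2.
    - mn.
    rewrite -mnn_integralZl; last 2 first.
    - by rewrite lee_fin expR_ge0.
    - mn.
    apply: eq_integral => s _.
    rewrite -mnn_integralZl; last 2 first.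
    - exact: mF.2.
    - mn.
    rewrite -mnn_integralZl; last 2 first.
    - by rewrite lee_fin expR_ge0.
    - mn.
    by [].
  rewrite (tonelli lebR mu); last mn.
  by apply: eq_integral => s _; rewrite tonelli//; mn.
by rewrite tonelli//; mn.
Qed.

Lemma kick_workN s th r r' :
  kick_work s th (- r')%R (- r)%R = (- kick_work s th r r')%R.
Proof.
rewrite /kick_work -mulrN /dotv -sumrN; congr (_ * _)%R.
by apply: eq_bigr => i _; rewrite !mxE addrC -opprD mulrN.
Qed.

(** The Jacobian [K] and the Gaussian peak [K'] are common to both sides; the exponents agree by
    [balance_exponent]. *)
Lemma detailed_balance s th r r' rho :
  (weight r (rho - kick_work s th r r') * kick_dens s th r r' =
   weight r' rho * kick_dens s th (- r') (- r))%R.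
Proof.
have v0 : (0 < 4 * eps * beta * sigma ^+ 2)%R by rewrite !mulr_gt0// exprn_gt0.
have sd0 : sd != 0%R by rewrite gt_eqF// sqrtr_gt0.
have sdE : (sd ^+ 2 = 4 * eps * beta * sigma ^+ 2)%R by rewrite sqr_sqrtr// ltW.
rewrite /weight /kick_dens !(gauss_pdfvE _ _ sd0) sdE.
set K := (_ ^+ d)%R; set K' := (normal_peak _ ^+ d)%R.
have pull (x y z t : R) : (x * y = z * t -> x * (K * (K' * y)) = z * (K * (K' * t)))%R.
  by move=> xyzt; transitivity (K * K' * (x * y))%R; [|rewrite xyzt]; ring.
apply: pull.
rewrite -!expRD; congr expR.
have := balance_exponent eps beta sigma (gU s th) r r' eps0 beta0 sigma0.
rewrite /kick_work; lra.
Qed.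

Lemma skew_kick (F G : Z -> \bar R) : mnn F -> mnn G ->
  pairing F (kick G) = pairing (flip G) (kick (flip F)).
Proof.
move=> mF mG.
have mJF : mnn (flip F) by rewrite /flip; mn.
have mJG : mnn (flip G) by rewrite /flip; mn.
rewrite (pairing_kickE F G mF mG) (pairing_kickE _ _ mJG mJF).
apply: eq_integral => th _.
apply: eq_integral => s _.
transitivity (\int[leb d]_r \int[leb d]_r' \int[lebR]_rho
  ((weight r' rho)%:E * (G (th, r', rho) * ((kick_dens s th (- r') (- r))%:E *
       F (th, r, (rho - kick_work s th r r')%R))))).
  apply: eq_integral => r _; apply: eq_integral => r' _.
  (* After the translation [G] sees [rho] and [F] sees [rho] minus the work: the roles of start and
     end are exchanged. *)
  rewrite (integral_shift (- kick_work s th r r')%R); last mn.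
  apply: eq_integral => rho _; rewrite subrK.
  set f := F _; set g := G _.
  transitivity ((weight r (rho - kick_work s th r r') * kick_dens s th r r')%:E * (f * g)).
    by rewrite (EFinM (weight _ _) (kick_dens _ _ _ _)) -!muleA; congr (_ * _); rewrite muleCA.
  rewrite detailed_balance (EFinM (weight _ _) (kick_dens _ _ _ _)) -!muleA; congr (_ * _).
  by rewrite (muleC f) muleCA.
symmetry; rewrite /flip.
(* Substitution of (-r', -r) for (r, r'), as a sign change, an exchange of integrals and a second
   sign change. *)
apply: etrans; first by apply: integral_leb_opp; mn.
apply: etrans; first by apply: tonelli; mn.
apply: etrans; first by apply: integral_leb_opp; mn.
apply: eq_integral => r _; apply: eq_integral => r' _; apply: eq_integral => rho _.
rewrite /flip_pt/= !opprK kick_workN; congr ((expR _)%:E * _).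
by rewrite /sqnormv /dotv; under eq_bigr do rewrite !mxE mulrNN.
Qed.

(** The weight ignores the position, so translating [th] by [- (c *: r)] moves the drift from [G] to
    [F], run backwards; changing the sign of [r] makes it run forwards. *)
Lemma skew_drift c (F G : Z -> \bar R) : mnn F -> mnn G ->
  pairing F (drift c G) = pairing (flip G) (drift c (flip F)).
Proof.
move=> mF mG; rewrite /pairing /drift /flip.
apply: etrans; first by apply: tonelli; mn.
symmetry.
apply: etrans; first by apply: tonelli; mn.
apply: etrans; first by apply: integral_leb_opp; mn.
apply: eq_integral => r _; symmetry.
apply: etrans; first by apply: (integral_leb_shift _ (- (c *: r))%R); mn.
apply: eq_integral => th _; apply: eq_integral => rho _.
rewrite /drift_pt /flip_pt/= subrK !opprK scalerN.
rewrite [X in _ = (_ * X)]muleC; congr ((expR _)%:E * _).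
by rewrite /sqnormv /dotv; under [in RHS]eq_bigr do rewrite !mxE mulrNN.
Qed.

(** * Palindromic composition *)

(* The properties of integration against a Markov kernel needed here; asking for
   them rather than for a kernel makes closure under composition immediate. *)
Record good (Q : (Z -> \bar R) -> Z -> \bar R) : Prop := {
  good_mnn : forall dX (X : measurableType dX) (H : X -> Z -> \bar R),
    mnn (fun p : X * Z => H p.1 p.2) -> mnn (fun p : X * Z => Q (H p.1) p.2);
  good_tonelli : forall H : R -> Z -> \bar R, mnn (fun p : R * Z => H p.1 p.2) ->
    forall z, \int[lebR]_t Q (H t) z = Q (fun z' => \int[lebR]_t H t z') z;
  good_add : forall F G, mnn F -> mnn G ->
    forall z, Q (fun z' => F z' + G z') z = Q F z + Q G z;
  good_scale : forall k F, 0 <= k -> mnn F ->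
    forall z, Q (fun z' => k * F z') z = k * Q F z;
  good_one : forall z, Q (fun=> 1) z = 1;
  good_shift : forall F t th r rho, Q F (th, r, (rho + t)%R) =
    Q (fun z' => F (z'.1, (z'.2 + t)%R)) (th, r, rho) }.

Lemma mnn_comp2 dX dY (X : measurableType dX) (Y : measurableType dY)
    (H : X -> Z -> \bar R) (f : Y -> X) (g : Y -> Z) :
  mnn (fun p : X * Z => H p.1 p.2) -> measurable_fun setT f -> measurable_fun setT g ->
  mnn (fun y => H (f y) (g y)).
Proof.
move=> mH mf mg.
exact: (mnn_comp (fun p : X * Z => H p.1 p.2) (fun y => (f y, g y)) mH
  (measurable_fun_pair mf mg)).
Qed.

Lemma good_mnn1 Q F : good Q -> mnn F -> mnn (Q F).
Proof.
move=> gQ mF.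
have /(_ _ R (fun=> F)) := good_mnn _ gQ => H.
have mH : mnn (fun p : R * Z => Q F p.2) by apply: H; mn.
by apply: (mnn_comp2 _ _ R Z (fun=> Q F) (fun=> 0%R) (fun z => z) mH); meas.
Qed.

Lemma good_comp Q1 Q2 : good Q1 -> good Q2 -> good (fun F => Q1 (Q2 F)).
Proof.
move=> g1 g2; split.
- by move=> dX X H mH; apply: (good_mnn _ g1 _ _ (fun x => Q2 (H x))); exact: (good_mnn _ g2).
- move=> H mH z.
  rewrite (good_tonelli _ g1 (fun t => Q2 (H t))); last exact: (good_mnn _ g2).
  by congr Q1; apply/funext => z'; exact: (good_tonelli _ g2).
- move=> F G mF mG z; rewrite -(good_add _ g1); [|exact: good_mnn1..].
  by congr Q1; apply/funext => z'; exact: (good_add _ g2).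
- move=> k F k0 mF z; rewrite -(good_scale _ g1) //; last exact: good_mnn1.
  by congr Q1; apply/funext => z'; exact: (good_scale _ g2).
- move=> z; rewrite -[RHS](good_one _ g1 z).
  by congr Q1; apply/funext => z'; exact: (good_one _ g2).
- move=> F t th r rho; rewrite (good_shift _ g1); congr Q1.
  by apply/funext => -[[th' r'] rho']; exact: (good_shift _ g2).
Qed.

Lemma good_iter n Q : good Q -> good (iter n Q).
Proof. by move=> gQ; elim: n => [|n IH]; [split|exact: good_comp]. Qed.

Lemma good_drift c : good (drift c).
Proof.
split=> //; rewrite /drift.
by move=> dX X H mH; apply: (mnn_comp2 _ _ X _ H) => //; rewrite /drift_pt/=; meas.
Qed.

(** Tonelli and linearity for the integrals over [s] and [eta], both of total mass 1. The shift
    property holds because the work does not depend on [rho]. *)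
Lemma good_kick : good kick.
Proof.
have mN dX (X : measurableType dX) (f : X -> vec) : measurable_fun setT f ->
    mnn (fun x => (gauss_pdfv sd (f x))%:E).
  by move=> mf; mn.
have N0 eta : 0 <= (gauss_pdfv sd eta)%:E by rewrite lee_fin gauss_pdfv_ge0.
split; rewrite /kick.
- move=> dX X H mH; do 2 apply: mnn_int; cbv beta.
  apply: mnn_mule; first by apply: mN; meas.
  apply: (mnn_comp2 _ _ X _ H) => //; first meas.
  by apply: measurable_kick_pt; meas.
- move=> H mH z.
  apply: etrans.
    apply: tonelli; apply: mnn_int; cbv beta.
    apply: mnn_mule; first by apply: mN; meas.
    by apply: (mnn_comp2 _ _ R _ H) => //; first [meas|apply: measurable_kick_pt; meas].
  apply: eq_integral => s _.
  apply: etrans.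
    apply: tonelli.
    apply: mnn_mule; first by apply: mN; meas.
    by apply: (mnn_comp2 _ _ R _ H) => //; first [meas|apply: measurable_kick_pt; meas].
  apply: eq_integral => eta _; rewrite mnn_integralZl//.
  by apply: (mnn_comp2 _ _ R _ H) => //; meas.
- move=> F G mF mG z.
  have mK (H : Z -> \bar R) : mnn H -> mnn (fun p : S * vec =>
      (gauss_pdfv sd p.2)%:E * H (kick_pt p.1 p.2 z)) by move=> mH; mn.
  have mKs (H : Z -> \bar R) s : mnn H -> mnn (fun eta : vec =>
      (gauss_pdfv sd eta)%:E * H (kick_pt s eta z)) by move=> mH; mn.
  have mI (H : Z -> \bar R) : mnn H -> mnn (fun s => \int[leb d]_eta
      ((gauss_pdfv sd eta)%:E * H (kick_pt s eta z))).
    by move=> mH; apply: mnn_int; exact: mK.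
  rewrite -(mnn_integralD _ _ _ (mI F mF) (mI G mG)); apply: eq_integral => s _.
  rewrite -(mnn_integralD _ _ _ (mKs F s mF) (mKs G s mG)).
  apply: eq_integral => eta _; rewrite ge0_muleDr//; [exact: mF.2|exact: mG.2].
- move=> k F k0 mF z.
  rewrite -mnn_integralZl//; last mn.
  apply: eq_integral => s _; rewrite -mnn_integralZl//; last mn.
  by apply: eq_integral => eta _; rewrite muleCA.
- move=> z; rewrite -[RHS](@probability_setT _ _ _ mu) -[mu setT]mul1e -integral_cst//.
  apply: eq_integral => s _; rewrite /= -[RHS](integral_gauss_pdfv d sd).
  by apply: eq_integral => eta _; rewrite mule1.
- move=> F t th r rho; apply: eq_integral => s _; apply: eq_integral => eta _.
  by rewrite /kick_pt/= addrAC.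
Qed.

(** [Q'] is the adjoint of [Q] conjugated by the momentum flip; [adj Q Q] is skew-reversibility. *)
Definition adj (Q Q' : (Z -> \bar R) -> Z -> \bar R) := forall F G, mnn F -> mnn G ->
  pairing F (Q G) = pairing (flip G) (Q' (flip F)).

Lemma flipK (F : Z -> \bar R) : flip (flip F) = F.
Proof. by apply/funext => -[[th r] rho]; rewrite /flip /flip_pt/= opprK. Qed.

Lemma mnn_flip (F : Z -> \bar R) : mnn F -> mnn (flip F).
Proof. by move=> mF; rewrite /flip; mn. Qed.

Lemma pairingC (F G : Z -> \bar R) : pairing F G = pairing G F.
Proof.
apply: eq_integral => th _; apply: eq_integral => r _; apply: eq_integral => rho _.
by rewrite [X in _ * X]muleC.
Qed.

Lemma pairing_flip (F G : Z -> \bar R) : mnn F -> mnn G -> pairing (flip F) G = pairing F (flip G).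
Proof.
move=> mF mG; apply: eq_integral => th _.
apply: etrans; first by apply: integral_leb_opp; rewrite /flip; mn.
apply: eq_integral => r _; apply: eq_integral => rho _.
rewrite /flip /flip_pt/= opprK; congr ((expR _)%:E * _).
by rewrite /sqnormv /dotv; under eq_bigr do rewrite !mxE mulrNN.
Qed.

(** Between the uses of the two hypotheses, symmetry of the pairing and self-adjointness of the flip
    put the result of [Q1'] into the first slot. *)
Lemma adj_comp Q1 Q1' Q2 Q2' : good Q1' -> good Q2 -> adj Q1 Q1' -> adj Q2 Q2' ->
  adj (fun F => Q1 (Q2 F)) (fun F => Q2' (Q1' F)).
Proof.
move=> g1 g2 a1 a2 F G mF mG.
have mQ2 : mnn (Q2 G) by exact: good_mnn1.
have mQ1 : mnn (Q1' (flip F)) by apply: good_mnn1 => //; exact: mnn_flip.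
rewrite (a1 _ _ mF mQ2) pairingC -(pairing_flip _ _ mQ1 mQ2).
by rewrite (a2 _ _ (mnn_flip _ mQ1) mG) flipK.
Qed.

Lemma adj_iter n Q Q' : good Q -> good Q' -> adj Q Q' -> adj (iter n Q) (iter n Q').
Proof.
move=> gQ gQ' a; elim: n => [|n IH].
  by move=> F G mF mG; rewrite /= pairingC -[X in pairing X _](flipK G) pairing_flip//;
    exact: mnn_flip.
(* Since adjunction reverses the order, the extra [Q'] has to be peeled off at the inner end. *)
move=> F G mF mG; rewrite (iterSr n Q').
have := adj_comp _ _ _ _ gQ' (good_iter n _ gQ) a IH F G mF mG.
by rewrite /= => ->.
Qed.

(** The trajectory with [T = n.+1] kicks: the first follows the initial half drift, the other [n]
    follow full drifts. *)
Definition leapfrog n (F : Z -> \bar R) : Z -> \bar R :=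
  drift (eps / (2 * sigma ^+ 2)) (kick
    (iter n (fun F => drift (eps / sigma ^+ 2) (kick F))
      (drift (eps / (2 * sigma ^+ 2)) F))).

Lemma good_leapfrog n : good (leapfrog n).
Proof.
apply: (good_comp _ _ (good_drift _)); apply: (good_comp _ _ good_kick).
apply: (good_comp _ _ (good_iter n _ _) (good_drift _)).
exact: (good_comp _ _ (good_drift _) good_kick).
Qed.

Lemma iter_swap A (f g : A -> A) n x :
  iter n (fun y => f (g y)) (f x) = f (iter n (fun y => g (f y)) x).
Proof. by elim: n => [//|n IH]; rewrite !iterS IH. Qed.

(* leapfrog is a palindrome in drift and kick, so that reversing the order of
   its factors gives it back. *)
Lemma skew_leapfrog n : adj (leapfrog n) (leapfrog n).
Proof.
pose h := (eps / (2 * sigma ^+ 2))%R; pose e := (eps / sigma ^+ 2)%R.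
have aK : adj kick kick by exact: skew_kick.
have aD c : adj (drift c) (drift c) by exact: skew_drift.
have gDK := good_comp _ _ (good_drift e) good_kick.
have gKD := good_comp _ _ good_kick (good_drift e).
have aDK : adj (fun F => drift e (kick F)) (fun F => kick (drift e F)).
  exact: (adj_comp _ _ _ _ (good_drift e) good_kick (aD e) aK).
have a1 := adj_iter n _ _ gDK gKD aDK.
have a2 := adj_comp _ _ _ _ (good_iter n _ gKD) (good_drift h) a1 (aD h).
have a3 := adj_comp _ _ _ _ good_kick
  (good_comp _ _ (good_iter n _ gDK) (good_drift h)) aK a2.
have a4 := adj_comp _ _ _ _ (good_drift h)
  (good_comp _ _ good_kick (good_comp _ _ (good_iter n _ gDK) (good_drift h)))
  (aD h) a3.
move=> F G mF mG; apply: etrans; first exact: (a4 F G mF mG).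
(* With D, K, H for full drift, kick and half drift, the reversed word is H (KD)^n K H, and (KD)^n K
   = K (DK)^n. *)
by cbv beta; rewrite (iter_swap _ kick (drift e)).
Qed.

(** With [first] false, every pass through the loop is a full drift followed by a kick with fresh
    noise. *)
Lemma noiseE_loop n (H : Z -> \bar R) th r rho : mnn H ->
  noiseE eps sigma beta mu n (fun l => H (amagold_loop eps sigma beta gU false th r rho l)) =
  iter n (fun F => drift (eps / sigma ^+ 2) (kick F)) H (th, r, rho).
Proof.
move=> mH; elim: n th r rho => [//|n IH] th r rho.
rewrite iterS [LHS]/=; apply: eq_integral => s _.
have mI : mnn (iter n (fun F => drift (eps / sigma ^+ 2) (kick F)) H).
  exact: (good_mnn1 _ _ (good_iter n _ (good_comp _ _ (good_drift _) good_kick)) mH).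
rewrite intRdE.
  by apply: eq_integral => eta _; rewrite IH.
under eq_fun do rewrite IH.
apply: mnn_mule; first mn.
apply: (mnn_comp _ (fun eta => kick_pt s eta
  (drift_pt (eps / sigma ^+ 2) (th, r, rho))) mI).
by apply: measurable_kick_pt; meas.
Qed.

(** The first pass only kicks, the initial half drift having been made before the loop; the final
    half drift is absorbed into the test function. *)
Lemma noiseE_proposal n (H : Z -> \bar R) th r : mnn H ->
  noiseE eps sigma beta mu n.+1
    (fun l => H (amagold_proposal eps sigma beta gU th r l)) =
  leapfrog n H (th, r, 0%R).
Proof.
move=> mH; pose c := (eps / (2 * sigma ^+ 2))%R.
have mI : mnn (iter n (fun F => drift (eps / sigma ^+ 2) (kick F)) (drift c H)).
  apply: (good_mnn1 _ _ (good_iter n _ (good_comp _ _ (good_drift _) good_kick))).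
  exact: (good_mnn1 _ _ (good_drift c) mH).
have mD : mnn (drift c H) by exact: (good_mnn1 _ _ (good_drift c) mH).
transitivity (noiseE eps sigma beta mu n.+1 (fun l => drift c H
    (amagold_loop eps sigma beta gU true (th + c *: r)%R r 0%R l))).
  congr noiseE; apply/funext => l; rewrite /amagold_proposal.
  by case: (amagold_loop _ _ _ _ _ _ _ _ _) => -[].
rewrite [LHS]/=; apply: eq_integral => s _.
rewrite intRdE.
  by apply: eq_integral => eta _; rewrite noiseE_loop.
under eq_fun do rewrite noiseE_loop//.
apply: mnn_mule; first mn.
apply: (mnn_comp _ (fun eta => kick_pt s eta (drift_pt c (th, r, 0%R))) mI).
by apply: measurable_kick_pt; meas.
Qed.

(** * The Metropolis test *)

Variables (Theta : set vec) (U : vec -> R) (n : nat).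
Hypotheses (mTheta : measurable Theta) (mU : measurable_fun setT U).

(** The starting energy [u] is a separate argument because [leapfrog] shows its test function only
    the end point [z]. *)
Definition accept (u : R) (z : Z) : R :=
  (\1_Theta z.1.1 * Num.min 1 (expR (u - U z.1.1 + z.2)))%R.

Definition accept_mass (x : vec * vec) (B : set (vec * vec)) : \bar R :=
  leapfrog n (fun z => (accept (U x.1) z * \1_B z.1)%:E) (x, 0%R).

(** No target set appears: a rejection leads to [perp x] whatever the proposal. *)
Definition reject_mass (x : vec * vec) : \bar R :=
  leapfrog n (fun z => (1 - accept (U x.1) z)%:E) (x, 0%R).

(** Indicator of the part of [B] over [Theta] lifted above the graph of [U]; it stands in for the
    acceptance test at either end of a path. *)
Definition slice (B : set (vec * vec)) (z : Z) : \bar R :=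
  (\1_Theta z.1.1 * \1_B z.1 * (U z.1.1 <= z.2)%R%:R)%:E.

Lemma accept_ge0 u z : (0 <= accept u z)%R.
Proof. by rewrite mulr_ge0// le_min ler01 expR_ge0. Qed.

Lemma accept_le1 u z : (accept u z <= 1)%R.
Proof.
rewrite /accept indicE; case: (_ \in _); rewrite ?mul0r ?ler01// mul1r.
by rewrite ge_min lexx.
Qed.

Lemma measurable_accept dX (X : measurableType dX) (u : X -> R) (z : X -> Z) :
  measurable_fun setT u -> measurable_fun setT z ->
  measurable_fun setT (fun x => accept (u x) (z x)).
Proof.
move=> mu' mz; apply: measurable_funM.
  by meas.
apply: measurable_minr; first meas.
apply: measurable_expR_comp; apply: measurable_funD; last meas.
apply: measurable_funB => //; meas.
Qed.

Lemma mnn_accept_mass B : measurable B -> mnn (fun x => accept_mass x B).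
Proof.
move=> mB; rewrite /accept_mass.
have mH : mnn (fun p : (vec * vec) * Z => (accept (U p.1.1) p.2 * \1_B p.2.1)%:E).
  apply: mnn_EFin => [|p]; last by rewrite mulr_ge0// accept_ge0.
  apply: measurable_funM; first by apply: measurable_accept; meas.
  by meas.
apply: (mnn_comp2 _ _ (vec * vec)%type (vec * vec)%type (fun x => leapfrog n (fun z => (accept (U x.1) z * \1_B z.1)%:E)) (fun x => x) (fun x => (x, 0%R))); [|meas..].
exact: (good_mnn _ (good_leapfrog n) _ _ (fun x z => (accept (U x.1) z * \1_B z.1)%:E) mH).
Qed.

Lemma mnn_reject_mass : mnn reject_mass.
Proof.
rewrite /reject_mass.
have mH : mnn (fun p : (vec * vec) * Z => (1 - accept (U p.1.1) p.2)%:E).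
  apply: mnn_EFin => [|p]; last by rewrite subr_ge0 accept_le1.
  apply: measurable_funB; first meas.
  by apply: measurable_accept; meas.
apply: (mnn_comp2 _ _ (vec * vec)%type (vec * vec)%type (fun x => leapfrog n (fun z => (1 - accept (U x.1) z)%:E)) (fun x => x) (fun x => (x, 0%R))); [|meas..].
exact: (good_mnn _ (good_leapfrog n) _ _ (fun x z => (1 - accept (U x.1) z)%:E) mH).
Qed.

Lemma kernelE x B : measurable B ->
  amagold_kernel eps sigma beta gU mu n.+1 Theta U x B =
  accept_mass x B + (\1_B (perp x))%:E * reject_mass x.
Proof.
move=> mB.
have ma : measurable_fun setT (accept (U x.1)) by apply: measurable_accept; meas.
have m1 : mnn (fun z : Z => (accept (U x.1) z * \1_B z.1)%:E).
  apply: mnn_EFin => [|p]; last by rewrite mulr_ge0// accept_ge0.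
  apply: measurable_funM => //.
  by meas.
have m2 : mnn (fun z : Z => (1 - accept (U x.1) z)%:E).
  apply: mnn_EFin => [|p]; last by rewrite subr_ge0 accept_le1.
  by apply: measurable_funB => //; meas.
have m3 : mnn (fun z : Z => (\1_B (perp x))%:E * (1 - accept (U x.1) z)%:E).
  by apply: mnn_mule => //; apply: mnn_EFin.
rewrite /accept_mass /reject_mass -(good_scale _ (good_leapfrog n))//.
rewrite -(good_add _ (good_leapfrog n))//.
case: x ma m1 m2 m3 => th r ma m1 m2 m3.
rewrite -noiseE_proposal; last exact: mnn_adde.
congr noiseE; apply/funext => l /=.
case: (amagold_proposal _ _ _ _ _ _ _) => -[th' r'] rho /=.
rewrite -EFinM -EFinD [X in (_ + X)%:E]mulrC; congr ((_ * _ + (1 - _) * _)%:E);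
  by rewrite /accept/= indicE; case: (_ \in _); rewrite ?mul0r ?mul1r.
Qed.

Lemma mnn_slice B : measurable B -> mnn (slice B).
Proof.
move=> mB; apply: mnn_EFin => [|z]; last by rewrite !mulr_ge0.
apply: measurable_funM; last first.
  apply: measurable_natb; apply: measurable_fun_ler; last meas.
  by meas.
apply: measurable_funM.
  by meas.
by meas.
Qed.

(* min(e^-a, e^-b) is the integral of e^-t over the t above both a and b: the
   Metropolis test becomes a pair of indicators, one for each end of the path. *)
Lemma min_tail (u v : R) (k : R) : (0 <= k)%R ->
  \int[lebR]_t ((expR (- t) * (u <= t)%R%:R)%:E * (k * (v <= t)%R%:R)%:E) =
  (expR (- u) * (k * Num.min 1 (expR (u - v))))%:E.
Proof.
move=> k0.
transitivity (\int[lebR]_t (k%:E * (expR (- t) * (Num.max u v <= t)%R%:R)%:E)).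
  apply: eq_integral => t _; rewrite -!EFinM ge_max; congr _%:E.
  by case: (u <= t)%R; case: (v <= t)%R; rewrite /= ?mulr1 ?mulr0 ?mul0r ?mulr0// mulrC.
rewrite mnn_integralZl//; last first.
  apply: mnn_EFin => [|t]; last by rewrite mulr_ge0// expR_ge0.
  apply: measurable_funM; first meas.
  by apply: measurable_natb; apply: measurable_fun_ler; meas.
rewrite integral_expR_tail -EFinM mulrCA; congr (_ * _)%:E.
have [uv|vu] := leP u v.
  rewrite min_r -?expRD; last by rewrite -expR0 ler_expR subr_le0.
  by congr expR; lra.
by rewrite min_l ?mulr1// -expR0 ler_expR subr_ge0 ltW.
Qed.

(** The initial [rho] is the threshold variable t of [min_tail]. Shift invariance restarts the
    trajectory at 0 and adds t at its end, and [good_tonelli] takes the integral over t inside the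
    operator. *)
Lemma slice_integral x A B : measurable A -> measurable B ->
  \int[lebR]_rho ((weight x.2 rho)%:E *
     (slice A (x.1, x.2, rho) * leapfrog n (slice B) (x.1, x.2, rho))) =
  (joint_unnorm Theta U sigma x * \1_A x)%:E * accept_mass x B.
Proof.
move=> mA mB; case: x => th r /=.
set u := U th.
(* The factors of the weight and of [slice A] that do not depend on t. *)
pose kappa := (\1_Theta th * \1_A (th, r) * expR (- ((2 * sigma ^+ 2)^-1 * sqnormv r)))%R.
pose H (t : R) (z : Z) : \bar R :=
  (expR (- t) * (u <= t)%R%:R)%:E * slice B (z.1, (z.2 + t)%R).
have kappa0 : 0 <= kappa%:E by rewrite lee_fin !mulr_ge0// expR_ge0.
have gL := good_leapfrog n.
have mS := mnn_slice _ mB.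
have mH : mnn (fun p : R * Z => H p.1 p.2).
  apply: mnn_mule.
    apply: mnn_EFin => [|t]; last by rewrite mulr_ge0// expR_ge0.
    apply: measurable_funM; first meas.
    by apply: measurable_natb; apply: measurable_fun_ler; meas.
  by apply: (mnn_comp (slice B)) => //; meas.
have mSt t : mnn (fun z : Z => slice B (z.1, (z.2 + t)%R)).
  by apply: (mnn_comp (slice B)) => //; meas.
transitivity (\int[lebR]_t (kappa%:E * leapfrog n (H t) (th, r, 0%R))).
  apply: eq_integral => t _.
  rewrite -[t in leapfrog n _ (_, _, t)]add0r (good_shift _ gL).
  rewrite /H (good_scale _ gL); [|by rewrite lee_fin mulr_ge0// expR_ge0|exact: mSt].
  rewrite !muleA; congr (_ * _); rewrite -!EFinM; congr _%:E.
  by rewrite /weight/= expRD -/u /kappa; ring.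
rewrite mnn_integralZl//; last first.
  apply: (mnn_comp2 _ _ R R (fun t => leapfrog n (H t)) (fun t => t) (fun=> (th, r, 0%R))); [|meas..].
  exact: (good_mnn _ gL).
rewrite (good_tonelli _ gL _ mH).
(* [min_tail] applies with thresholds [u] and [U z.1.1 - z.2], whose difference is the log of the
   acceptance ratio. *)
rewrite (_ : (fun z => _) = fun z => (expR (- u))%:E * (accept u z * \1_B z.1)%:E); last first.
  apply/funext => z; rewrite /H /slice/=.
  transitivity (\int[lebR]_t ((expR (- t) * (u <= t)%R%:R)%:E *
     (\1_Theta z.1.1 * \1_B z.1 * (U z.1.1 - z.2 <= t)%R%:R)%:E)).
    by apply: eq_integral => t _; rewrite lerBlDl.
  rewrite min_tail ?mulr_ge0// -EFinM; congr (_ * _)%:E.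
  rewrite /accept (_ : u - (U z.1.1 - z.2) = u - U z.1.1 + z.2)%R; ring.
rewrite (good_scale _ gL)//; last first.
  apply: mnn_EFin => [|p]; last by rewrite mulr_ge0// accept_ge0.
  apply: measurable_funM; first by apply: measurable_accept; meas.
  by meas.
rewrite muleA -EFinM; congr (_%:E * _).
by rewrite /joint_unnorm/= /kappa -/u [(- u - _)%R]addrC expRD; ring.
Qed.

(** Left unnormalised; [intRd2_pi_joint] restores the constant. *)
Definition Pi (f : vec * vec -> \bar R) : \bar R :=
  \int[leb d]_th \int[leb d]_r ((joint_unnorm Theta U sigma (th, r))%:E * f (th, r)).

Lemma measurable_joint_unnorm : measurable_fun setT (joint_unnorm Theta U sigma).
Proof. by rewrite /joint_unnorm; meas. Qed.

Lemma joint_unnorm_ge0 x : (0 <= joint_unnorm Theta U sigma x)%R.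
Proof. by rewrite mulr_ge0// expR_ge0. Qed.

Lemma mnn_joint (f : vec * vec -> \bar R) : mnn f ->
  mnn (fun x => (joint_unnorm Theta U sigma x)%:E * f x).
Proof.
move=> mf; apply: mnn_mule => //; apply: mnn_EFin; last exact: joint_unnorm_ge0.
exact: measurable_joint_unnorm.
Qed.

Lemma mnn_indic (A : set (vec * vec)) : measurable A ->
  mnn (fun x : vec * vec => (\1_A x : R)%:E).
Proof. by move=> mA; apply: mnn_EFin => //; meas. Qed.

Lemma PiD f g : mnn f -> mnn g -> Pi (fun x => f x + g x) = Pi f + Pi g.
Proof.
move=> mf mg; have mjf := mnn_joint _ mf; have mjg := mnn_joint _ mg.
rewrite -mnn_integralD; last 2 first.
- exact: (mnn_integral (leb d) _ mjf).
- exact: (mnn_integral (leb d) _ mjg).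
apply: eq_integral => th _; rewrite -mnn_integralD; last 2 first.
- by apply: (mnn_comp _ (fun r => (th, r)) mjf); meas.
- by apply: (mnn_comp _ (fun r => (th, r)) mjg); meas.
by apply: eq_integral => r _; rewrite ge0_muleDr//; [exact: mf.2|exact: mg.2].
Qed.

Lemma measurable_perp : measurable_fun setT (@perp R d).
Proof. by rewrite /perp; meas. Qed.

Lemma measurable_perp_preimage (B : set (vec * vec)) : measurable B ->
  measurable (perp @^-1` B).
Proof.
move=> mB; rewrite -[X in measurable X]setTI.
exact: measurable_perp.
Qed.

Lemma indic_perp (A : set (vec * vec)) x : \1_(perp @^-1` A) x = \1_A (perp x) :> R.
Proof. by rewrite !indicE; congr (_%:R); apply/idP/idP; rewrite !inE. Qed.

(** Both sides are pairings of slices by [slice_integral], and flipping the slice of a set gives the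
    slice of its preimage under [perp]; [skew_leapfrog] concludes. *)
Lemma Pi_accept_skew A B : measurable A -> measurable B ->
  Pi (fun x => (\1_A x)%:E * accept_mass x B) =
  Pi (fun x => (\1_(perp @^-1` B) x)%:E * accept_mass x (perp @^-1` A)).
Proof.
move=> mA mB.
have E C D : measurable C -> measurable D ->
    Pi (fun x => (\1_C x)%:E * accept_mass x D) = pairing (slice C) (leapfrog n (slice D)).
  move=> mC mD; apply: eq_integral => th _; apply: eq_integral => r _.
  by rewrite (slice_integral (th, r))// EFinM muleA.
have F C : flip (slice C) = slice (perp @^-1` C).
  by apply/funext => -[[th r] rho]; rewrite /flip /slice /flip_pt/= indic_perp.
have mpA := measurable_perp_preimage _ mA; have mpB := measurable_perp_preimage _ mB.
apply: etrans; first exact: (E A B mA mB).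
apply: etrans; last exact: (esym (E _ _ mpB mpA)).
rewrite -!F; exact: (skew_leapfrog n _ _ (mnn_slice _ mA) (mnn_slice _ mB)).
Qed.

Let G := amagold_kernel eps sigma beta gU mu n.+1 Theta U.

Lemma Pi_skew A B : measurable A -> measurable B ->
  Pi (fun x => (\1_A x)%:E * G x B) =
  Pi (fun x => (\1_(perp @^-1` B) x)%:E * G x (perp @^-1` A)).
Proof.
move=> mA mB.
have mpA := measurable_perp_preimage _ mA; have mpB := measurable_perp_preimage _ mB.
have E C D : measurable C -> measurable D -> Pi (fun x => (\1_C x)%:E * G x D) =
    Pi (fun x => (\1_C x)%:E * accept_mass x D) +
    Pi (fun x => (\1_C x)%:E * ((\1_D (perp x))%:E * reject_mass x)).
  move=> mC mD; rewrite -PiD; last 2 first.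
  - by apply: mnn_mule; [exact: mnn_indic|exact: mnn_accept_mass].
  - apply: mnn_mule; first exact: mnn_indic.
    apply: mnn_mule; last exact: mnn_reject_mass.
    exact: (mnn_indic (perp @^-1` D) (measurable_perp_preimage _ mD)).
  congr Pi; apply/funext => x; rewrite /G kernelE// ge0_muleDr//.
  - exact: (mnn_accept_mass _ mD).2.
  - by rewrite mule_ge0//; exact: mnn_reject_mass.2.
apply: etrans; first exact: (E A B mA mB).
apply: etrans; last exact: (esym (E _ _ mpB mpA)).
apply: (congr2 adde); first exact: Pi_accept_skew.
(* Rejected part: as [perp] is an involution, both sides carry [\1_A x * \1_B (perp x)] at [x]. *)
apply: (congr1 Pi).
apply/funext => -[th r]; rewrite !muleA; congr (_ * _).
by rewrite muleC !indic_perp /perp/= opprK.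
Qed.

(** Needed to deduce stationarity from (skew-)reversibility. *)
Lemma kernelT x : amagold_kernel eps sigma beta gU mu n.+1 Theta U x setT = 1.
Proof.
rewrite kernelE// indicT mul1e /accept_mass /reject_mass.
have ma : measurable_fun setT (accept (U x.1)) by apply: measurable_accept; meas.
rewrite -(good_add _ (good_leapfrog n)); last 2 first.
- apply: mnn_EFin => [|p]; last by rewrite mulr_ge0// accept_ge0.
  by apply: measurable_funM => //; meas.
- apply: mnn_EFin => [|p]; last by rewrite subr_ge0 accept_le1.
  by apply: measurable_funB => //; meas.
rewrite -[RHS](good_one _ (good_leapfrog n) (x, 0%R)).
apply: (congr1 (fun F => leapfrog n F (x, 0%R))); apply/funext => z.
by rewrite -EFinD indicT mulr1 addrC subrK.
Qed.

(** * Normalisation and momentum resampling *)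

Hypothesis hZ : 0 < Z_theta Theta U < +oo.

Lemma mnn_kernel B : measurable B -> mnn (fun x => G x B).
Proof.
move=> mB; rewrite [X in mnn X](_ : _ = fun x => accept_mass x B +
  (\1_B (perp x))%:E * reject_mass x); last first.
  by apply/funext => x; rewrite /G kernelE.
apply: mnn_adde; first exact: mnn_accept_mass.
apply: mnn_mule; last exact: mnn_reject_mass.
apply: mnn_EFin => //; apply: measurable_indic_comp => //; exact: measurable_perp.
Qed.

Lemma intRd2E (f : vec * vec -> \bar R) : mnn f ->
  intRd2 f = \int[leb d]_th \int[leb d]_r f (th, r).
Proof.
move=> mf; have mfr th : mnn (fun r => f (th, r)).
  by apply: (mnn_comp _ (fun r => (th, r)) mf); meas.
have mI : mnn (fun th => \int[leb d]_r f (th, r)) by exact: (mnn_integral (leb d) _ mf).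
have E : (fun th => intRd (fun r => f (th, r))) = fun th => \int[leb d]_r f (th, r).
  by apply/funext => th; exact: intRdE.
by rewrite /intRd2 E intRdE.
Qed.

Let Zt0 : (0 < fine (Z_theta Theta U))%R.
Proof. by apply: fine_gt0. Qed.

Let k := ((fine (Z_joint Theta U sigma))^-1)%R.

Let k0 : 0 <= k%:E.
Proof.
rewrite lee_fin invr_ge0 fine_ge0//.
rewrite /Z_joint intRd2E; last first.
  apply: mnn_EFin; last exact: joint_unnorm_ge0.
  exact: measurable_joint_unnorm.
apply: integral_ge0 => th _; apply: integral_ge0 => r _.
by rewrite lee_fin; exact: joint_unnorm_ge0.
Qed.

Lemma intRd2_pi_joint (f : vec * vec -> \bar R) : mnn f ->
  intRd2 (fun x => (pi_joint Theta U sigma x)%:E * f x) = k%:E * Pi f.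
Proof.
move=> mf; have mj := mnn_joint _ mf.
have E : (fun x => (pi_joint Theta U sigma x)%:E * f x) =
    fun x => k%:E * ((joint_unnorm Theta U sigma x)%:E * f x).
  by apply/funext => x; rewrite muleA -EFinM mulrC.
rewrite E intRd2E; last first.
  by apply: mnn_mule => //; split=> [|x //]; exact: measurable_cst.
transitivity (\int[leb d]_th (k%:E * \int[leb d]_r
   ((joint_unnorm Theta U sigma (th, r))%:E * f (th, r)))).
  apply: eq_integral => th _; apply: mnn_integralZl => //.
  by apply: (mnn_comp _ (fun r => (th, r)) mj); meas.
by apply: mnn_integralZl => //; exact: (mnn_integral (leb d) _ mj).
Qed.

Lemma joint_unnorm_perp x :
  joint_unnorm Theta U sigma (perp x) = joint_unnorm Theta U sigma x.
Proof.
rewrite /joint_unnorm /sqnormv /dotv/=.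
by under eq_bigr do rewrite !mxE mulrNN.
Qed.

Lemma pi_joint_skew A B : measurable A -> measurable B ->
  intRd2 (fun x => (pi_joint Theta U sigma x * \1_A x)%:E * G x B) =
  intRd2 (fun x => (pi_joint Theta U sigma x * \1_(perp @^-1` B) x)%:E *
    G x (perp @^-1` A)).
Proof.
move=> mA mB.
have mpA := measurable_perp_preimage _ mA; have mpB := measurable_perp_preimage _ mB.
have E C D : measurable C -> measurable D ->
    intRd2 (fun x => (pi_joint Theta U sigma x * \1_C x)%:E * G x D) =
    k%:E * Pi (fun x => (\1_C x)%:E * G x D).
  move=> mC mD; rewrite -intRd2_pi_joint; last first.
    by apply: mnn_mule; [exact: mnn_indic|exact: mnn_kernel].
  by congr intRd2; apply/funext => x; rewrite EFinM muleA.
apply: etrans; first exact: (E A B mA mB).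
apply: etrans; last exact: (esym (E _ _ mpB mpA)).
by apply: (congr1 (mule k%:E)); exact: Pi_skew.
Qed.

(** Skew-reversibility with the whole space as first set leaves the mass of the preimage of [B]
    under [perp], which equals that of [B] since the target is even in the momentum. *)
Lemma pi_joint_stationary B : measurable B ->
  intRd2 (fun x => (pi_joint Theta U sigma x)%:E * G x B) =
  intRd2 (fun x => (pi_joint Theta U sigma x * \1_B x)%:E).
Proof.
move=> mB; have mpB := measurable_perp_preimage _ mB.
have mT : measurable [set: vec * vec] by exact: measurableT.
transitivity (intRd2 (fun x => (pi_joint Theta U sigma x * \1_setT x)%:E * G x B)).
  by congr intRd2; apply/funext => x; rewrite indicT mulr1.
apply: etrans; first exact: (pi_joint_skew _ _ mT mB).
have E C : measurable C -> intRd2 (fun x => (pi_joint Theta U sigma x * \1_C x)%:E) =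
    k%:E * Pi (fun x => (\1_C x)%:E).
  move=> mC; rewrite -intRd2_pi_joint; last exact: mnn_indic.
  by congr intRd2; apply/funext => x; rewrite EFinM.
transitivity (intRd2 (fun x => (pi_joint Theta U sigma x * \1_(perp @^-1` B) x)%:E)).
  by congr intRd2; apply/funext => x; rewrite preimage_setT /G kernelT mule1.
apply: etrans; first exact: (E _ mpB).
apply: etrans; last exact: (esym (E _ mB)).
apply: (congr1 (mule k%:E)).
apply: eq_integral => th _; apply: etrans.
  apply: integral_leb_opp.
  apply: (mnn_comp _ (fun r => (th, r)) (mnn_joint _ (mnn_indic _ mpB))); meas.
apply: eq_integral => r _; rewrite indic_perp.
by rewrite -[(th, (- r)%R)]/(perp (th, r)) joint_unnorm_perp /perp/= opprK.
Qed.

Lemma pi_theta_ge0 th : (0 <= pi_theta Theta U th)%R.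
Proof. by rewrite !mulr_ge0// ?expR_ge0// invr_ge0 ltW. Qed.

Lemma gauss_sigmaE (r : vec) : gauss_pdfv sigma r =
  (normal_peak sigma ^+ d * expR (- ((2 * sigma ^+ 2)^-1 * sqnormv r)))%R.
Proof.
by rewrite gauss_pdfvE ?gt_eqF// -mulr_natl mulrC [(_^-1 * _)%R]mulrC mulrC.
Qed.

Lemma mnn_gauss : mnn (fun r : vec => (gauss_pdfv sigma r)%:E).
Proof. by mn. Qed.

(** The momentum factor of [joint_unnorm] is the Gaussian density divided by its peak. *)
Lemma Z_jointE : Z_joint Theta U sigma =
  ((normal_peak sigma ^+ d)^-1)%:E * Z_theta Theta U.
Proof.
have pk0 : (0 < normal_peak sigma ^+ d)%R by rewrite exprn_gt0// normal_peak_gt0// gt_eqF.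
have mt : mnn (fun th => (\1_Theta th * expR (- U th))%:E).
  apply: mnn_EFin => [|th]; last by rewrite mulr_ge0// expR_ge0.
  by meas.
rewrite /Z_theta -intRdZl// ?lee_fin ?invr_ge0 ?ltW//.
congr intRd; apply/funext => th.
transitivity (intRd (fun r : vec =>
   ((normal_peak sigma ^+ d)^-1 * (\1_Theta th * expR (- U th)))%:E * (gauss_pdfv sigma r)%:E)).
  congr intRd; apply/funext => r; rewrite gauss_sigmaE -EFinM; congr _%:E.
  rewrite /joint_unnorm/= expRD; field; by rewrite gt_eqF.
rewrite intRdZl ?(intRdE _ _ mnn_gauss) ?integral_gauss_pdfv ?mule1 ?EFinM//.
- by rewrite lee_fin !mulr_ge0// ?invr_ge0 ?expR_ge0// ltW.
- exact: mnn_gauss.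
Qed.

(** Position and momentum are independent under the target, with the momentum law used for
    resampling; this gives both the marginal and the link between the two chains. *)
Lemma pi_jointE x : pi_joint Theta U sigma x =
  (pi_theta Theta U x.1 * gauss_pdfv sigma x.2)%R.
Proof.
have pk0 : (0 < normal_peak sigma ^+ d)%R by rewrite exprn_gt0// normal_peak_gt0// gt_eqF.
rewrite /pi_joint Z_jointE gauss_sigmaE /joint_unnorm /pi_theta expRD.
have -> : fine (((normal_peak sigma ^+ d)^-1)%:E * Z_theta Theta U) =
    ((normal_peak sigma ^+ d)^-1 * fine (Z_theta Theta U))%R.
  by rewrite fineM// fin_numElt; case/andP: hZ => Z0 ->; rewrite andbT (lt_trans _ Z0)// ltNyr.
by field; rewrite !gt_eqF.
Qed.

Lemma pi_joint_marginal A : measurable A ->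
  intRd2 (fun x => (pi_joint Theta U sigma x * \1_A x.1)%:E) =
  intRd (fun th => (pi_theta Theta U th * \1_A th)%:E).
Proof.
move=> mA; congr intRd; apply/funext => th.
transitivity (intRd (fun r : vec =>
   (pi_theta Theta U th * \1_A th)%:E * (gauss_pdfv sigma r)%:E)).
  by congr intRd; apply/funext => r; rewrite pi_jointE -EFinM mulrAC.
rewrite intRdZl ?(intRdE _ _ mnn_gauss) ?integral_gauss_pdfv ?mule1//.
- by rewrite lee_fin mulr_ge0//; exact: pi_theta_ge0.
- exact: mnn_gauss.
Qed.

(** * The resampled chain on positions *)

Let K := amagold_kernel_resample eps sigma beta gU mu n.+1 Theta U.

Lemma resample_joint (A B : set vec) : measurable A -> measurable B ->
  intRd (fun th => (pi_theta Theta U th * \1_A th)%:E * K th B) =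
  intRd2 (fun x => (pi_joint Theta U sigma x * \1_(A `*` setT) x)%:E *
    G x (B `*` setT)).
Proof.
move=> mA mB; congr intRd; apply/funext => th.
have mBT : measurable (B `*` [set: vec]) by exact: measurableX.
rewrite /K /amagold_kernel_resample -intRdZl.
- congr intRd; apply/funext => r; rewrite pi_jointE muleA -EFinM.
  rewrite mulrAC; congr ((_ * _)%:E * _).
  rewrite !indicE (_ : (_ \in A `*` _) = (th \in A))//.
  by apply/idP/idP; rewrite !inE => // -[].
- by rewrite lee_fin mulr_ge0//; exact: pi_theta_ge0.
- apply: mnn_mule; first exact: mnn_gauss.
  by apply: (mnn_comp _ (fun r => (th, r)) (mnn_kernel _ mBT)); meas.
Qed.

Lemma resample_reversible (A B : set vec) : measurable A -> measurable B ->
  intRd (fun th => (pi_theta Theta U th * \1_A th)%:E * K th B) =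
  intRd (fun th => (pi_theta Theta U th * \1_B th)%:E * K th A).
Proof.
move=> mA mB.
have mAT : measurable (A `*` [set: vec]) by exact: measurableX.
have mBT : measurable (B `*` [set: vec]) by exact: measurableX.
apply: etrans; first exact: (resample_joint A B mA mB).
apply: etrans; last exact: (esym (resample_joint B A mB mA)).
(* [perp] fixes the position, so a cylinder is its own preimage and skew-reversibility reads as
   reversibility. *)
exact: (pi_joint_skew _ _ mAT mBT).
Qed.

Lemma resample_stationary (B : set vec) : measurable B ->
  intRd (fun th => (pi_theta Theta U th)%:E * K th B) =
  intRd (fun th => (pi_theta Theta U th * \1_B th)%:E).
Proof.
move=> mB.
have KT th : K th setT = 1.
  rewrite /K /amagold_kernel_resample setXTT.
  rewrite (_ : (fun r => _) = fun r : vec => (gauss_pdfv sigma r)%:E).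
    by rewrite (intRdE _ _ mnn_gauss) integral_gauss_pdfv.
  by apply/funext => r; rewrite kernelT mule1.
transitivity (intRd (fun th => (pi_theta Theta U th * \1_setT th)%:E * K th B)).
  by congr intRd; apply/funext => th; rewrite indicT mulr1.
apply: etrans; first exact: (resample_reversible _ _ (@measurableT _ _) mB).
by congr intRd; apply/funext => th; rewrite KT mule1.
Qed.

End operators.

(** The kernel may have an atom at the rejected state, hence the balance identities are stated
    integrated over pairs of measurable sets. *)
Theorem theorem1 (R : realType) (d : nat)
  (Theta : set 'rV[R]_d) (U : 'rV[R]_d -> R)
  (eps sigma beta : R) (T : nat)
  (dS : measure_display) (S : measurableType dS) (mu : probability S R)
  (Ut : S -> 'rV[R]_d -> R) :
  measurable Theta ->
  (forall th, differentiable U th) ->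
  0 < eps -> 0 < sigma -> 0 < beta -> (1 <= T)%N ->
  (forall s th, differentiable (Ut s) th) ->
  measurable_fun [set: S * 'rV[R]_d] (fun p => gradv (Ut p.1) p.2) ->
  (0 < Z_theta Theta U < +oo)%E ->
  let gU := fun s => gradv (Ut s) in
  let K := amagold_kernel_resample eps sigma beta gU mu T Theta U in
  let G := amagold_kernel eps sigma beta gU mu T Theta U in
  let piT := pi_theta Theta U in
  let piJ := pi_joint Theta U sigma in
  (* (i) momentum resampled at every transition: the chain on theta is
     reversible w.r.t. pi(theta), and pi(theta) is stationary *)
  ((forall A B : set 'rV[R]_d, measurable A -> measurable B ->
      intRd (fun th => ((piT th * \1_A th)%:E * K th B)%E)
      = intRd (fun th => ((piT th * \1_B th)%:E * K th A)%E)) /\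
   (forall B : set 'rV[R]_d, measurable B ->
      intRd (fun th => ((piT th)%:E * K th B)%E)
      = intRd (fun th => (piT th * \1_B th)%:E))) /\
  (* (ii) no resampling: the chain on (theta, r) is skew-reversible w.r.t.
     pi(theta, r) and the involution (theta, r) |-> (theta, -r); pi(theta, r)
     is stationary and its theta-marginal is pi(theta) *)
  ((forall x, piJ x = piJ (perp x)) /\
   (forall A B : set ('rV[R]_d * 'rV[R]_d), measurable A -> measurable B ->
      intRd2 (fun x => ((piJ x * \1_A x)%:E * G x B)%E)
      = intRd2 (fun x => ((piJ x * \1_(perp @^-1` B) x)%:E
                          * G x (perp @^-1` A))%E)) /\
   (forall B : set ('rV[R]_d * 'rV[R]_d), measurable B ->
      intRd2 (fun x => ((piJ x)%:E * G x B)%E)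
      = intRd2 (fun x => (piJ x * \1_B x)%:E)) /\
   (forall A : set 'rV[R]_d, measurable A ->
      intRd2 (fun x => (piJ x * \1_A x.1)%:E)
      = intRd (fun th => (piT th * \1_A th)%:E))).

Proof.
move=> mTheta dU eps0 sigma0 beta0 T1 dUt mgU hZ gU K G piT piJ.
have mU : measurable_fun setT U.
  by apply: continuous_rV_measurable => th; exact: differentiable_continuous.
(* [T >= 1] provides the [n] with [T = n.+1] that indexes [leapfrog]. *)
case: T T1 @K @G => [//|n] _ K G.
split; [split=> [A B mA mB|B mB]|split=> [x|]].
- exact: (resample_reversible eps sigma beta mu gU mgU eps0 sigma0 beta0 Theta U n mTheta mU hZ).
- exact: (resample_stationary eps sigma beta mu gU mgU eps0 sigma0 beta0 Theta U n mTheta mU hZ).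
- by rewrite /piJ /pi_joint joint_unnorm_perp.
split=> [A B mA mB|].
  exact: (pi_joint_skew eps sigma beta mu gU mgU eps0 sigma0 beta0 Theta U n mTheta mU).
split=> [B mB|A mA].
  exact: (pi_joint_stationary eps sigma beta mu gU mgU eps0 sigma0 beta0 Theta U n mTheta mU).
exact: (pi_joint_marginal sigma sigma0 Theta U mTheta mU hZ).
Qed.
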